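(* Let $A=(a_n)_{n=1}^N$ and $B=(b_n)_{n=1}^M$ be elements of $\mathcal A$, and let $\{\mathcal P_n\}_{n=1}^N$ and $\{\mathcal Q_n\}_{n=1}^M$ be sequences of pyramids of finite observable diameter. If $$\mathcal X^{1-\|A\|_1}+\sum_{n=1}^N\mathcal P_n^{a_n}=\mathcal X^{1-\|B\|_1}+\sum_{n=1}^M\mathcal Q_n^{b_n},$$ then (i) $N=M$, and (ii) there exists a bijective map $f:[N]\to[N]$ such that $\mathcal P_n=\mathcal Q_{f(n)}$ and $a_n=b_{f(n)}$ for each $n\in[N]$.
   Context: An mm-space is a triple $(X,d_X,\mu_X)$ where $(X,d_X)$ is a complete separable metric space and $\mu_X$ is a Borel probability measure on it; $\mathcal X$ denotes the set of mm-isomorphism classes of mm-spaces. $Y\prec X$ means there is a 1-Lipschitz map $f:X\to Y$ with $f_*\mu_X=\mu_Y$. The box distance $\square(X,Y)$ is the infimum of $\max\{\operatorname{dis}(S),1-\pi(S)\}$ over couplings $\pi$ of $\mu_X,\mu_Y$ and Borel $S\subset X\times Y$, with $\operatorname{dis}(S)=\sup\{|d_X(x,x')-d_Y(y,y')|:(x,y),(x',y')\in S\}$. A pyramid is a nonempty subset $\mathcal P\subset\mathcal X$ closed in the box topology, closed downward under $\prec$, and directed with respect to $\prec$. $\mathcal X$ itself is a pyramid. $\overline{\mathbb N}=\mathbb N\cup\{\infty\}$, $[N]=\{1,\dots,N\}$ for finite $N$, $[\infty]=\mathbb N$. For a countable index set $I$, weights $a_i\in(0,1]$ with $\sum_i a_i=1$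 and pyramids $\mathcal P_i$, the direct sum $\sum_{i\in I}\mathcal P_i^{a_i}$ is the set of $X\in\mathcal X$ for which there exist $X_i\in\mathcal P_i$ and 1-Lipschitz maps $f_i:X_i\to X$ with $\mu_X=\sum_i a_i(f_i)_*\mu_{X_i}$. $\mathcal A$ is the set consisting of $(0)$ together with all sequences $A=(a_n)_{n=1}^N$, $N\in\overline{\mathbb N}$, with $a_n\in(0,1]$, nonincreasing, and $\|A\|_1:=\sum_n a_n\le1$. The notation $\mathcal X^{1-\|A\|_1}+\sum_{n=1}^N\mathcal P_n^{a_n}$ means $\mathcal X$ if $\|A\|_1=0$; $\sum_{n=0}^N\mathcal P_n^{a_n}$ with $a_0=1-\|A\|_1$, $\mathcal P_0=\mathcal X$ if $0<\|A\|_1<1$; and $\sum_{n=1}^N\mathcal P_n^{a_n}$ if $\|A\|_1=1$. For $0<\kappa<1$: $\operatorname{diam}(\mu;1-\kappa)=\inf\{\operatorname{diam}A: \mu(A)\ge1-\kappa\}$, $\operatorname{ObsDiam}(X;-\kappa)=\sup\{\operatorname{diam}(f_*\mu_X;1-\kappa): f:X\to\mathbb R\text{ 1-Lipschitz}\}$, $\operatorname{ObsDiam}(\mathcal P;-\kappa)=\sup_{X\in\mathcal P}\operatorname{ObsDiam}(X;-\kappa)$. A pyramid has finite observable diameter if this is finite for every $0<\kappa<1$.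
   Formalization: The element (0) of 𝒜 is read as the empty sequence (N = 0, no pyramids attached); read as a one-term sequence with a_1 = 0, conclusion (ii) fails for A = B = (0) with any 𝒫_1 ≠ 𝒬_1, since both sides are then 𝒳. *)

(* Defs.v *)
From HB Require Import structures.
From mathcomp Require Import all_boot all_order all_algebra.
From mathcomp Require Import all_classical all_reals all_analysis.

Set Implicit Arguments.
Unset Strict Implicit.
Unset Printing Implicit Defensive.

Import Order.TTheory GRing.Theory Num.Theory.
Import numFieldNormedType.Exports.
Local Open Scope classical_set_scope.
Local Open Scope ring_scope.

(* Extended naturals  \bar N = N ∪ {∞}  and  [N] = {0,...,N-1}        *)
(* (0-based indexing: paper index n+1 corresponds to index n here).   *)
Inductive natbar := Fin of nat | Inf.

Definition nlt (n : nat) (N : natbar) : Prop :=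
  match N with Fin k => (n < k)%N | Inf => True end.

Definition sums_to {R : realType} (K : natbar) (u : nat -> R) (s : R) : Prop :=
  match K with
  | Fin k => \sum_(i < k) u i = s
  | Inf => (fun n => \sum_(i < n) u i) @ \oo --> s
  end.

Section MetricNotions.
Context {R : realType} {T : Type} (d : T -> T -> R).

Definition is_open (U : set T) : Prop :=
  forall x, U x -> exists2 e : R, 0 < e & forall y, d x y < e -> U y.

Definition borel (A : set T) : Prop :=
  forall S : set (set T),
    (forall U, is_open U -> S U) ->
    (forall U, S U -> S (~` U)) ->
    (forall F : nat -> set T, (forall n, S (F n)) -> S (\bigcup_n F n)) ->
    S A.

(* Borel probability measure (given as a set function, relevant on Borel sets) *)
Definition is_prob_measure (mu : set T -> R) : Prop :=
  [/\ mu set0 = 0, mu setT = 1,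
      (forall A, borel A -> 0 <= mu A) &
      (forall F : nat -> set T, (forall n, borel (F n)) ->
         (forall i j, i <> j -> F i `&` F j = set0) ->
         sums_to Inf (fun n => mu (F n)) (mu (\bigcup_n F n)))].

Definition is_metric : Prop :=
  [/\ forall x y, d x y = 0 <-> x = y,
      forall x y, d x y = d y x &
      forall x y z, d x z <= d x y + d y z].

Definition is_complete : Prop :=
  forall u : nat -> T,
    (forall e : R, 0 < e -> exists N, forall m n, (N <= m)%N -> (N <= n)%N -> d (u m) (u n) < e) ->
    exists x, forall e : R, 0 < e -> exists N, forall n, (N <= n)%N -> d (u n) x < e.

Definition is_separable : Prop :=
  exists s : nat -> T, forall x (e : R), 0 < e -> exists n, d x (s n) < e.

End MetricNotions.

Record mmSpace (R : realType) := MMSpace {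
  mm_carrier :> Type;
  mm_dist : mm_carrier -> mm_carrier -> R;
  mm_meas : set mm_carrier -> R;
  mm_metric : is_metric mm_dist;
  mm_complete : is_complete mm_dist;
  mm_separable : is_separable mm_dist;
  mm_prob : is_prob_measure mm_dist mm_meas
}.

Section MM.
Context {R : realType}.

Definition lip1 (X Y : mmSpace R) (f : X -> Y) : Prop :=
  forall x x' : X, mm_dist (f x) (f x') <= mm_dist x x'.

Definition dominated (Y X : mmSpace R) : Prop :=
  exists f : X -> Y, lip1 f /\
    forall B : set Y, borel (@mm_dist R Y) B -> mm_meas (f @^-1` B) = mm_meas B.

Definition prod_dist (X Y : mmSpace R) (p q : X * Y) : R :=
  Num.max (mm_dist p.1 q.1) (mm_dist p.2 q.2).

Definition coupling (X Y : mmSpace R) (pi : set (X * Y) -> R) : Prop :=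
  [/\ is_prob_measure (@prod_dist X Y) pi,
      (forall A : set X, borel (@mm_dist R X) A -> pi (A `*` setT) = mm_meas A) &
      (forall B : set Y, borel (@mm_dist R Y) B -> pi (setT `*` B) = mm_meas B)].

Definition dis (X Y : mmSpace R) (S : set (X * Y)) : \bar R :=
  ereal_sup [set (`| mm_dist p.1 q.1 - mm_dist p.2 q.2 |)%:E | p in S & q in S].

Definition box (X Y : mmSpace R) : \bar R :=
  ereal_inf [set maxe (dis S) (1 - pi S)%:E |
             pi in [set pi | coupling pi] &
             S in [set S | borel (@prod_dist X Y) S]].

Definition mmpred := mmSpace R -> Prop.

Definition box_closed (P : mmpred) : Prop :=
  forall X, (forall e : R, 0 < e -> exists2 Y, P Y & (box X Y < e%:E)%E) -> P X.

Definition is_pyramid (P : mmpred) : Prop :=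
  [/\ exists X, P X,
      box_closed P,
      (forall X Y, P X -> dominated Y X -> P Y) &
      (forall X Y, P X -> P Y -> exists2 Z, P Z & dominated X Z /\ dominated Y Z)].

Definition rdist (x y : R) : R := `|x - y|.

Definition diamE (A : set R) : \bar R :=
  ereal_sup [set (`|x - y|)%:E | x in A & y in A].

Definition partial_diam (X : mmSpace R) (f : X -> R) (kappa : R) : \bar R :=
  ereal_inf [set diamE A | A in
     [set A | borel rdist A /\ 1 - kappa <= mm_meas (f @^-1` A)]].

Definition ObsDiam (X : mmSpace R) (kappa : R) : \bar R :=
  ereal_sup [set partial_diam f kappa | f in
     [set f : X -> R | forall x x', `|f x - f x'| <= mm_dist x x']].

Definition ObsDiamP (P : mmpred) (kappa : R) : \bar R :=
  ereal_sup [set ObsDiam X kappa | X in P].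

Definition finite_obsdiam (P : mmpred) : Prop :=
  forall kappa : R, 0 < kappa < 1 -> (ObsDiamP P kappa < +oo)%E.

(* Direct sum  \sum_{i in [K]} P_i^{w_i}  (as a set of mm-isomorphism  *)
(* classes: X belongs to it iff some space mm-isomorphic to X, i.e.   *)
(* at box distance 0, admits the required representation)            *)
Definition dsum (K : natbar) (w : nat -> R) (P : nat -> mmpred) : mmpred :=
  fun X => exists X' : mmSpace R, box X X' = 0%E /\
    exists (Xs : nat -> mmSpace R) (fs : forall i, Xs i -> X'),
      (forall i, nlt i K -> P i (Xs i)) /\
      (forall i, nlt i K -> lip1 (fs i)) /\
      (forall B : set X', borel (@mm_dist R X') B ->
         sums_to K (fun i => w i * mm_meas (fs i @^-1` B)) (mm_meas B)).

Record seqA := SeqA { lenA : natbar; valA : nat -> R }.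

Definition norm1 (A : seqA) : \bar R :=
  match lenA A with
  | Fin k => (\sum_(i < k) valA A i)%:E
  | Inf => ereal_sup (range (fun n => (\sum_(i < n) valA A i)%:E))
  end.

(* The element (0) of \mathcal A is encoded as the empty sequence (lenA = Fin 0). *)
Definition inA (A : seqA) : Prop :=
  [/\ forall n, nlt n (lenA A) -> 0 < valA A n <= 1,
      forall n, nlt n.+1 (lenA A) -> valA A n.+1 <= valA A n &
      (norm1 A <= 1%:E)%E].

Definition mixsum (A : seqA) (P : nat -> mmpred) : mmpred :=
  if norm1 A == 0%E then (fun _ => True)
  else if (norm1 A < 1%:E)%E then
    dsum (match lenA A with Fin k => Fin k.+1 | Inf => Inf end)
         (fun i => match i with 0%N => 1 - fine (norm1 A) | n.+1 => valA A n end)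
         (fun i => match i with 0%N => (fun _ => True) | n.+1 => P n end)
  else dsum (lenA A) (valA A) P.

End MM.

(* Main.v *)
(** Write [P_n], [a_n] for the summands and weights on one side and [Q_m], [b_m]
    for those on the other, and pick [X_n] in [P_n].  Place the [X_n], with masses
    [a_n], at mutual distance at least [L] on a chain, together with many light
    components that carry the mass [1 - ||A||_1] of the full pyramid.  This chain
    lies in the other direct sum, so up to a small box distortion its measure
    dominates [\sum_m b_m nu_m], where [nu_m] makes it an element of [Q_m].  Since
    [Q_m] has finite observable diameter, for [L] large [nu_m] is concentrated on
    one component; heavy [b_m] avoid the light components.  Hence the [b_m] can be
    packed into the [a_n], and conversely; as both sequences are sorted, they are
    equal.  For equal sequences a packing is a permutation up to the end of each
    block of equal weights, and a component filled exactly by [nu_m] is box-close to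
    an element of [Q_m]; by closedness and directedness of pyramids one permutation
    gives [P_(sigma m) \subset Q_m] for all [m] of the block.  The reverse inclusions
    and the finiteness of the block turn inclusions into equalities. *)

Require Import Defs.
From HB Require Import structures.
From mathcomp Require Import all_boot all_order all_algebra.
From mathcomp Require Import all_classical all_reals all_analysis.
From mathcomp Require Import measurable_realfun lra.

Set Implicit Arguments.
Unset Strict Implicit.
Unset Printing Implicit Defensive.

Import Order.TTheory GRing.Theory Num.Theory.
Import numFieldNormedType.Exports.
Local Open Scope classical_set_scope.
Local Open Scope ring_scope.

(** * Borel sets and finite measures *)

Section Series.
Context {R : realType}.
Implicit Types (u : nat -> R) (s : R).

(** For nonnegative terms, this links limits of real partial sums to extended-real series, for which
    countable additivity and interchange of sums are available. *)
Lemma sums_to_nneseries u s : (forall n, 0 <= u n) ->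
  sums_to Inf u s <-> (\sum_(0 <= i <oo) (u i)%:E = s%:E)%E.
Proof.
move=> u0; split=> [|us]; rewrite /sums_to.
- move=> us; apply/cvg_lim => //.
  have -> : (fun n => \sum_(0 <= i < n) (u i)%:E)%E =
            EFin \o (fun n => \sum_(i < n) u i).
    by apply/funext => n /=; rewrite sumEFin big_mkord.
  exact: cvg_EFin (nearW _ _) us.
- have cv : (\sum_(0 <= i < n) (u i)%:E)%E @[n --> \oo] --> s%:E.
    rewrite -us; apply: is_cvg_nneseries => n _ _.
    by rewrite lee_fin.
  move/fine_cvgP : cv => [_]; apply: cvg_trans; apply: near_eq_cvg.
  by apply: nearW => n /=; rewrite sumEFin /= big_mkord.
Qed.

Lemma sums_to_unique (K : natbar) u s t : sums_to K u s -> sums_to K u t -> s = t.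
Proof. by case: K => [k <- <-//|] us ut; exact: cvg_unique us ut. Qed.

Lemma sums_to_finite u (k : nat) : (forall n, (k <= n)%N -> u n = 0) ->
  sums_to Inf u (\sum_(i < k) u i).
Proof.
move=> uk; apply: cvg_near_cst; exists k => // n /= kn.
rewrite -!(big_mkord xpredT) (big_cat_nat (n := k)) //=.
by rewrite [X in _ + X]big_nat_cond [X in _ + X]big1 ?addr0// => i /andP[/andP[/uk]].
Qed.

Lemma sums_to_le u s : (forall n, 0 <= u n) -> sums_to Inf u s ->
  forall k : nat, \sum_(i < k) u i <= s.
Proof.
move=> u0 us k; rewrite -(cvg_lim _ us)//.
apply: (@nondecreasing_cvgn_le _ (fun n => \sum_(i < n) u i)); last by apply/cvg_ex; exists s.
apply/nondecreasing_seqP => n.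
by rewrite big_ord_recr lerDl.
Qed.

Lemma sums_to_ge0 u s : (forall n, 0 <= u n) -> sums_to Inf u s -> 0 <= s.
Proof. by move=> u0 /(sums_to_le u0)/(_ 0%N); rewrite big_ord0. Qed.

Lemma sums_toD u v s t : sums_to Inf u s -> sums_to Inf v t ->
  sums_to Inf (fun n => u n + v n) (s + t).
Proof.
move=> us vt; rewrite /sums_to; under eq_fun do rewrite big_split.
exact: cvgD.
Qed.

Lemma sums_toZ u s (c : R) : sums_to Inf u s ->
  sums_to Inf (fun n => c * u n) (c * s).
Proof.
move=> us; rewrite /sums_to; under eq_fun do rewrite -big_distrr.
exact: (@cvgMl_tmp R _ _ _ _ _ _ us).
Qed.

Lemma sums_to_shift u s (J : nat) :
  sums_to Inf (fun n => u (J + n)%N) s ->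
  sums_to Inf u (\sum_(i < J) u i + s).
Proof.
move=> us; rewrite /sums_to -(cvg_shiftn J).
under eq_fun do rewrite addnC big_split_ord /=.
by apply: cvgD => //; exact: cvg_cst.
Qed.

Lemma sums_to_exists u (M : R) : (forall n, 0 <= u n) ->
  (forall k, \sum_(i < k) u i <= M) -> exists s, sums_to Inf u s.
Proof.
move=> u0 uM; exists (sup (range (fun n => \sum_(i < n) u i))).
apply: nondecreasing_cvgn.
- by apply/nondecreasing_seqP => n; rewrite big_ord_recr lerDl.
- by exists M => _ [k _ <-].
Qed.

Lemma sums_to_cvg0 u s : sums_to Inf u s -> u @ \oo --> 0.
Proof.
move=> us; have us1 : (fun n => \sum_(i < n.+1) u i) @ \oo --> s.
  by rewrite (cvg_shiftS (fun n => \sum_(i < n) u i)).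
have -> : u = (fun n => \sum_(i < n.+1) u i) \- (fun n => \sum_(i < n) u i).
  by apply/funext => n /=; rewrite big_ord_recr addrAC subrr add0r.
by have := cvgB us1 us; rewrite subrr; apply.
Qed.

End Series.

Section Borel.
Context {R : realType} {T : Type} (d : T -> T -> R).

Lemma borel_open U : is_open d U -> borel d U.
Proof. by move=> oU S SO _ _; exact: SO. Qed.

Lemma borelC A : borel d A -> borel d (~` A).
Proof. by move=> bA S SO SC SU; apply: (SC); exact: bA. Qed.

Lemma borel_bigcup (F : nat -> set T) : (forall n, borel d (F n)) ->
  borel d (\bigcup_n F n).
Proof. by move=> bF S SO SC SU; apply: (SU) => n; exact: bF. Qed.

Lemma borel0 : borel d set0.
Proof. by apply: borel_open. Qed.

Lemma borelT : borel d setT.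
Proof. by rewrite -setC0; exact: borelC borel0. Qed.

Lemma borelU A B : borel d A -> borel d B -> borel d (A `|` B).
Proof.
move=> bA bB; rewrite -bigcup2E; apply: borel_bigcup => -[|[|n]] //=.
exact: borel0.
Qed.

Lemma borelI A B : borel d A -> borel d B -> borel d (A `&` B).
Proof.
by move=> bA bB; rewrite -[_ `&` _]setCK setCI; apply: borelC; apply: borelU; exact: borelC.
Qed.

Lemma borelD A B : borel d A -> borel d B -> borel d (A `\` B).
Proof. by move=> bA bB; rewrite setDE; apply: borelI => //; exact: borelC. Qed.

Lemma borel_closed A : is_open d (~` A) -> borel d A.
Proof. by move=> oA; rewrite -[A]setCK; apply: borelC; exact: borel_open. Qed.

(** Finite measures of arbitrary mass: restrictions, multiples and defects of probability measures
    are not normalised. *)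
Definition is_meas (mu : set T -> R) : Prop :=
  [/\ mu set0 = 0, (forall A, borel d A -> 0 <= mu A) &
      (forall F : nat -> set T, (forall n, borel d (F n)) ->
         (forall i j, i <> j -> F i `&` F j = set0) ->
         sums_to Inf (fun n => mu (F n)) (mu (\bigcup_n F n)))].

Lemma is_prob_measureP mu :
  is_prob_measure d mu <-> is_meas mu /\ mu setT = 1.
Proof. by split=> [[m0 m1 mge ma]|[[m0 mge ma] m1]]; split. Qed.

Lemma prob_meas mu : is_prob_measure d mu -> is_meas mu.
Proof. by move/is_prob_measureP => []. Qed.

Section measure_facts.
Variable mu : set T -> R.
Hypothesis mum : is_meas mu.

Lemma meas_ge0 A : borel d A -> 0 <= mu A.
Proof. by case: mum => _ + _ => /[apply]. Qed.

Lemma measU A B : borel d A -> borel d B -> A `&` B = set0 ->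
  mu (A `|` B) = mu A + mu B.
Proof.
move=> bA bB AB0; case: mum => m0 _ ma; pose F := bigcup2 A B.
have bF n : borel d (F n) by case: n => [|[|n]] //=; exact: borel0.
have dF i j : i <> j -> F i `&` F j = set0.
  by case: i j => [|[|i]] [|[|j]] //= _; rewrite ?set0I ?setI0 // setIC.
have := ma F bF dF; rewrite /F bigcup2E => h.
apply: (sums_to_unique h).
have := @sums_to_finite _ (fun n => mu (bigcup2 A B n)) 2.
rewrite !big_ord_recl big_ord0 addr0 /=; apply.
by case=> [|[|n]].
Qed.

Lemma measI A B : borel d A -> borel d B -> mu A = mu (A `&` B) + mu (A `\` B).
Proof.
move=> bA bB; rewrite -measU ?setUIDK//; [exact: borelI|exact: borelD|].
by rewrite setDE setIACA setICr setI0.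
Qed.

Lemma meas_le A B : borel d A -> borel d B -> A `<=` B -> mu A <= mu B.
Proof.
move=> bA bB AB; rewrite (measI bB bA) (setIidr AB) lerDl.
by apply: meas_ge0; exact: borelD.
Qed.

Lemma meas_le_setI A B : borel d A -> borel d B ->
  mu A <= mu (A `&` B) + mu (~` B).
Proof.
move=> bA bB; rewrite (measI bA bB) lerD2l.
by apply: meas_le; [exact: borelD|exact: borelC|move=> x []].
Qed.

Lemma meas_setC A : borel d A -> mu setT = mu A + mu (~` A).
Proof. by move=> bA; rewrite (measI borelT bA) setTI setTD. Qed.

End measure_facts.

Lemma is_measD mu nu : is_meas mu -> is_meas nu ->
  is_meas (fun A => mu A + nu A).
Proof.
move=> [m0 mge ma] [n0 nge na]; split; first by rewrite m0 n0 addr0.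
- by move=> A bA; rewrite addr_ge0 ?mge ?nge.
- by move=> F bF dF; apply: sums_toD; [exact: ma|exact: na].
Qed.

Lemma is_measZ mu (c : R) : 0 <= c -> is_meas mu ->
  is_meas (fun A => c * mu A).
Proof.
move=> c0 [m0 mge ma]; split; first by rewrite m0 mulr0.
- by move=> A bA; rewrite mulr_ge0 ?mge.
- by move=> F bF dF; apply: sums_toZ; exact: ma.
Qed.

Lemma is_measB mu nu : is_meas mu -> is_meas nu ->
  (forall A, borel d A -> nu A <= mu A) -> is_meas (fun A => mu A - nu A).
Proof.
move=> [m0 mge ma] [n0 nge na] le; split; first by rewrite m0 n0 subrr.
- by move=> A bA; rewrite subr_ge0 le.
- move=> F bF dF; rewrite -mulN1r.
  have -> : (fun n => mu (F n) - nu (F n)) = (fun n => mu (F n) + -1 * nu (F n)).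
    by apply/funext => n; rewrite mulN1r.
  by apply: sums_toD; [exact: ma|apply: sums_toZ; exact: na].
Qed.

End Borel.

Definition bmeasurable {R : realType} {T U : Type} (dT : T -> T -> R)
  (dU : U -> U -> R) (f : T -> U) :=
  forall B, borel dU B -> borel dT (f @^-1` B).

Section Pushforward.
Context {R : realType} {T U : Type} (dT : T -> T -> R) (dU : U -> U -> R).
Variable f : T -> U.

(** The sets with Borel preimage form a sigma-algebra containing the open sets, and [borel] is the
    intersection of all such families. *)
Lemma continuous_bmeasurable : (forall U, is_open dU U -> is_open dT (f @^-1` U)) ->
  bmeasurable dT dU f.
Proof.
move=> of_ B bB; apply: (bB (fun B => borel dT (f @^-1` B))).
- by move=> V oV; apply: borel_open; exact: of_.
- by move=> V bV; rewrite preimage_setC; exact: borelC.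
- by move=> F bF; rewrite preimage_bigcup; exact: borel_bigcup.
Qed.

Lemma lipschitz_bmeasurable : (forall x y, dU (f x) (f y) <= dT x y) ->
  bmeasurable dT dU f.
Proof.
move=> lf; apply: continuous_bmeasurable => V oV x /oV[e e0 eV]; exists e => // y xy.
by apply: eV; exact: le_lt_trans xy.
Qed.

Lemma is_meas_restrict_preimage mu (E : set T) : is_meas dT mu -> borel dT E ->
  bmeasurable dT dU f -> is_meas dU (fun B => mu (f @^-1` B `&` E)).
Proof.
move=> [m0 mge ma] bE mf; split; first by rewrite preimage_set0 set0I m0.
- by move=> A bA; apply: mge; apply: borelI => //; exact: mf.
- move=> F bF dF; rewrite preimage_bigcup setI_bigcupl.
  apply: ma => [n|i j ij]; first by apply: borelI => //; exact: mf.
  by rewrite setIACA setIid -preimage_setI dF// preimage_set0 set0I.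
Qed.

Lemma is_meas_pushforward mu : is_meas dT mu ->
  bmeasurable dT dU f -> is_meas dU (fun B => mu (f @^-1` B)).
Proof.
move=> mm mf; have := is_meas_restrict_preimage mm (@borelT _ _ dT) mf.
by under [X in is_meas _ X -> _]eq_fun do rewrite setIT.
Qed.

Lemma is_prob_pushforward mu : is_prob_measure dT mu ->
  bmeasurable dT dU f -> is_prob_measure dU (fun B => mu (f @^-1` B)).
Proof.
move=> /is_prob_measureP[mm m1] mf; apply/is_prob_measureP; split.
  exact: is_meas_pushforward.
by rewrite preimage_setT.
Qed.

End Pushforward.

(** * Comparison with the measures of the library *)

(* The base point makes the carrier a [pointedType], as required by
   [measurableType]. *)
Definition borel_space {R : realType} {T : Type} (d : T -> T -> R) (x0 : T) : Type := T.

Section BorelSpace.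
Context {R : realType} {T : Type} (d : T -> T -> R) (x0 : T).
Local Notation B := (borel_space d x0).

HB.instance Definition _ := gen_eqMixin B.
HB.instance Definition _ := gen_choiceMixin B.
HB.instance Definition _ := isPointed.Build B x0.
HB.instance Definition _ := @isMeasurable.Build default_measure_display B
  (borel d) (@borel0 R T d) (@borelC R T d) (@borel_bigcup R T d).

(** [mu] is constrained on Borel sets only, whereas a measure structure asks for nonnegativity on
    every set; hence the value [0] elsewhere. *)
Definition emeas (mu : set T -> R) (_ : is_meas d mu) (A : set B) : \bar R :=
  if `[< borel d A >] then (mu A)%:E else 0%E.

Variables (mu : set T -> R) (mum : is_meas d mu).
Local Notation m := (emeas mum).

Lemma emeasE (A : set T) : borel d A -> m A = (mu A)%:E.
Proof. by move=> bA; rewrite /emeas; case: asboolP. Qed.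

Let emeas0 : m set0 = 0%E.
Proof. by rewrite emeasE; [case: mum => ->|exact: borel0]. Qed.

Let emeas_ge0 A : (0 <= m A)%E.
Proof.
by rewrite /emeas; case: asboolP => // bA; rewrite lee_fin; exact: meas_ge0 mum _ bA.
Qed.

Let emeas_sigma_additive : semi_sigma_additive m.
Proof.
move=> F mF tF mUF; rewrite emeasE//.
have -> : (fun n => \sum_(0 <= i < n) m (F i))%E =
          EFin \o (fun n => \sum_(i < n) mu (F i)).
  apply/funext => n /=; rewrite -sumEFin big_mkord; apply: eq_bigr => i _.
  by rewrite emeasE//; exact: mF.
apply: cvg_EFin (nearW _ _) _ => //.
have [_ _] := mum; apply; first exact: mF.
move=> i j ij; have /trivIsetP/(_ i j I I) := tF; apply; exact/eqP.
Qed.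

HB.instance Definition _ := isMeasure.Build _ B R m emeas0 emeas_ge0 emeas_sigma_additive.

Let emeas_fin : fin_num_fun m.
Proof. by move=> A mA; rewrite emeasE. Qed.

HB.instance Definition _ := Measure_isFinite.Build _ B R m emeas_fin.

End BorelSpace.

(** * Lifting a dominated measure along a measurable map *)

Section LiftDominated.
Context {R : realType} {W Y : Type} (dW : W -> W -> R) (dY : Y -> Y -> R).
Variables (w0 : W) (p : W -> Y).
Hypothesis mp : bmeasurable dW dY p.

(* The lift has density [min (g o p) 1], with [g] the Radon-Nikodym derivative
   of [nu] with respect to the image of [pi]; truncating at [1] loses no mass. *)
Lemma lift_dominated_measure (pi : set W -> R) (nu : set Y -> R) :
  is_meas dW pi -> is_meas dY nu ->
  (forall B, borel dY B -> nu B <= pi (p @^-1` B)) ->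
  exists rho, [/\ is_meas dW rho,
    forall C, borel dW C -> rho C <= pi C &
    forall B, borel dY B -> rho (p @^-1` B) = nu B].
Proof.
move=> mpi mnu le.
pose y0 := p w0.
have mpp := is_meas_pushforward mpi mp.
pose m1 : {finite_measure set (borel_space dW w0) -> \bar R} := @emeas _ _ _ w0 _ mpi.
pose m2 : {finite_measure set (borel_space dY y0) -> \bar R} := @emeas _ _ _ y0 _ mpp.
pose n : {finite_measure set (borel_space dY y0) -> \bar R} := @emeas _ _ _ y0 _ mnu.
have nm : n `<< m2.
  apply/null_content_dominatesP => A mA; rewrite /m2/n/= !emeasE//= => -[A0].
  apply/eqP; rewrite eqe eq_le -{1}A0 le//=; exact: meas_ge0 mnu _ mA.
pose g := Radon_Nikodym_SigmaFinite.f n m2.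
have g0 := Radon_Nikodym_SigmaFinite.f_ge0 nm.
have gi := Radon_Nikodym_SigmaFinite.f_integrable nm.
have gE := Radon_Nikodym_SigmaFinite.f_integral nm.
have mg : measurable_fun setT g by exact: measurable_int gi.
pose h (y : borel_space dY y0) : \bar R := mine (g y) 1%E.
have mh : measurable_fun setT h.
  by apply: measurable_mine => //; exact: measurable_cst.
have h0 y : (0 <= h y)%E by rewrite /h le_min g0 lee01.
have mp' : measurable_fun (setT : set (borel_space dW w0)) (p : borel_space dW w0 -> borel_space dY y0).
  by move=> _ A mA; rewrite setTI; exact: mp.
have mhp : measurable_fun setT (h \o p : borel_space dW w0 -> \bar R).
  exact: measurableT_comp mh mp'.
have hp0 w : (0 <= (h \o p) w)%E by exact: h0.
pose r (C : set (borel_space dW w0)) : \bar R := (\int[m1]_(x in C) (h \o p) x)%E.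
have r0 C : (0 <= r C)%E by apply: integral_ge0 => w _; exact: hp0.
have rle (C : set W) : borel dW C -> (r C <= (pi C)%:E)%E.
  move=> bC; have -> : (pi C)%:E = (\int[m1]_(x in C) cst 1 x)%E.
    by rewrite integral_cst// mul1e /m1/= emeasE.
  apply: ge0_le_integral => //.
  - by apply: measurable_funTS.
  - by move=> w _; rewrite /h ge_min lexx orbT.
have rfin C : borel dW C -> r C \is a fin_num.
  by move=> bC; rewrite ge0_fin_numE//; apply: le_lt_trans (rle _ bC) (ltry _).
exists (fine \o r); split; first split.
- by rewrite /= /r integral_set0.
- by move=> C bC; rewrite fine_ge0.
- move=> F bF dF; apply/sums_to_nneseries => [k|]; first by rewrite fine_ge0.
  rewrite /= fineK; last by apply: rfin; exact: borel_bigcup.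
  rewrite /r ge0_integral_bigcup//.
  + by apply: eq_eseriesr => k _; rewrite fineK//; exact: rfin.
  + by apply: measurable_funTS.
  + by apply/trivIsetP => i j _ _ /eqP; exact: dF.
- by move=> C bC /=; rewrite -lee_fin fineK ?rle ?rfin.
- move=> B bB /=; suff -> : r (p @^-1` B) = (nu B)%:E by [].
  have -> : r (p @^-1` B) = (\int[m2]_(y in B) h y)%E.
    rewrite (@eq_measure_integral _ _ _ _ (pushforward m1 (p : borel_space dW w0 -> borel_space dY y0))); last first.
      move=> A mA _; rewrite /m2/= emeasE// /pushforward /m1/= emeasE//; exact: mp.
    by rewrite ge0_integral_pushforward//; exact: measurable_funTS.
  have nuE A : borel dY A -> (nu A)%:E = (\int[m2]_(y in A) g y)%E.
    by move=> bA; rewrite -gE// /n/= emeasE.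
  apply/eqP; rewrite eq_le; apply/andP; split.
    rewrite nuE//; apply: ge0_le_integral => //; try exact: measurable_funTS.
    by move=> y _; rewrite /h ge_min lexx.
  (* On [E] the truncated density is [g] and integrates to [nu]; off [E] it is [1], and there [nu]
     is bounded by the image of [pi] by hypothesis. *)
  pose E : set (borel_space dY y0) := [set y | (g y <= 1)%E].
  have bE : measurable E.
    by rewrite -[E]setTI; apply: emeasurable_fun_infty_c.
  have BE := borelI bB bE.
  have BCE := borelD bB bE.
  rewrite -[in leRHS](setUIDK B E) ge0_integral_setU//; last 2 first.
  - exact: measurable_funTS.
  - by apply/disj_setPS => y [[_ yE] [_ /(_ yE)]].
  rewrite (measI mnu bB bE) EFinD; apply: leeD.
  - rewrite nuE//.
    rewrite [leRHS](_ : _ = (\int[m2]_(y in B `&` E) g y)%E)//.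
    apply: eq_integral => y; rewrite inE => -[_ yE].
    by rewrite /h; apply/min_idPl.
  - rewrite [leRHS](_ : _ = (\int[m2]_(y in B `\` E) cst 1 y)%E).
      by rewrite integral_cst// mul1e /m2/= emeasE// lee_fin le.
    apply: eq_integral => y; rewrite inE => -[_ /negP]; rewrite -ltNge => yE.
    by rewrite /h; apply/min_idPr; exact: ltW.
Qed.

End LiftDominated.

(** * Couplings *)

Section MetricFacts.
Context {R : realType} {T : Type} (d : T -> T -> R).
Hypothesis dm : is_metric d.

Lemma dist_xx x : d x x = 0.
Proof. by case: dm => h _ _; apply/h. Qed.

Lemma dist_sym x y : d x y = d y x.
Proof. by case: dm. Qed.

Lemma dist_triangle x y z : d x z <= d x y + d y z.
Proof. by case: dm. Qed.

Lemma dist_ge0 x y : 0 <= d x y.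
Proof. by have := dist_triangle x y x; rewrite dist_xx (dist_sym y x); lra. Qed.

Lemma dist_eq0 x y : d x y = 0 -> x = y.
Proof. by case: dm => h _ _ /h. Qed.

Lemma is_open_ball x (e : R) : is_open d [set y | d y x < e].
Proof.
move=> y /= yx; exists (e - d y x); first by rewrite subr_gt0.
by move=> z yz /=; have := dist_triangle z y x; rewrite (dist_sym z y); lra.
Qed.

End MetricFacts.

Section Products.
Context {R : realType}.
Implicit Types X Y Z : mmSpace R.

Definition point_of X : X := projT1 (cid (mm_separable X)) 0%N.

Lemma bmeasurable_fst X Y : bmeasurable (@prod_dist R X Y) (@mm_dist R X) fst.
Proof. by apply: lipschitz_bmeasurable => p q; rewrite /prod_dist le_max lexx. Qed.

Lemma bmeasurable_snd X Y : bmeasurable (@prod_dist R X Y) (@mm_dist R Y) snd.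
Proof. by apply: lipschitz_bmeasurable => p q; rewrite /prod_dist le_max lexx orbT. Qed.

Lemma setXT_fst (A B : Type) (S : set A) : S `*` [set: B] = fst @^-1` S.
Proof. by apply/seteqP; split=> [[x y] []|[x y]]. Qed.

Lemma setTX_snd (A B : Type) (S : set B) : [set: A] `*` S = snd @^-1` S.
Proof. by apply/seteqP; split=> [[x y] []|[x y]]. Qed.

(** By separability, an open set of the max metric is a countable union of products of balls centred
    on dense sequences, so it lies in the product sigma-algebra. *)
Lemma borel_prod_measurable X Y (x0 : X) (y0 : Y) (C : set (X * Y)) :
  borel (@prod_dist R X Y) C ->
  measurable (C : set (borel_space (@mm_dist R X) x0 * borel_space (@mm_dist R Y) y0)).
Proof.
pose M (D : set (X * Y)) := measurable
  (D : set (borel_space (@mm_dist R X) x0 * borel_space (@mm_dist R Y) y0)).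
move=> bC; apply: (bC M); last 2 first.
- by move=> U; exact: measurableC.
- by move=> F mF; exact: bigcupT_measurable.
move=> U oU.
have [s hs] := mm_separable X; have [t ht] := mm_separable Y.
have mX := mm_metric X; have mY := mm_metric Y.
pose D (i j k : nat) : set (X * Y) :=
  [set x | mm_dist x (s i) < k.+1%:R^-1] `*` [set y | mm_dist y (t j) < k.+1%:R^-1].
(* Rectangles that are not inside [U], and codes that decode to nothing, contribute the empty
   set. *)
pose F n := if unpickle n is Some (i, j, k) then
  if `[< D i j k `<=` U >] then D i j k else set0 else set0.
have mF n : M (F n).
  rewrite /F; case: (unpickle n) => [[[i j] k]|]; last exact: measurable0.
  case: ifP => _; last exact: measurable0.
  by apply: measurableX; apply: borel_open; exact: is_open_ball.
suff -> : U = \bigcup_n F n by exact: bigcupT_measurable.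
apply/seteqP; split=> [[x y] Uxy|z [n _]]; last first.
  rewrite /F; case: (unpickle n) => [[[i j] k]|] //.
  by case: asboolP => // h; exact: h.
have [e e0 eU] := oU _ Uxy.
have [k ke] : exists k : nat, k.+1%:R^-1 < e / 2.
  have e20 : 0 < e / 2 by rewrite divr_gt0.
  have [k /= _ /(_ k (leqnn k)) h] := near_infty_natSinv_lt (PosNum e20).
  by exists k.
have k0 : 0 < k.+1%:R^-1 :> R by [].
have [i xi] := hs x _ k0; have [j yj] := ht y _ k0.
exists (pickle (i, j, k)) => //; rewrite /F pickleK.
case: asboolP => // -[]; move=> [x' y'] []; rewrite /=.
move: (k.+1%:R^-1 : R) ke xi yj {k0} => q qe xi yj xi' yj'.
apply: eU; rewrite /prod_dist /= gt_max; apply/andP; split.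
- by have := dist_triangle mX x (s i) x'; rewrite (dist_sym mX (s i) x'); lra.
- by have := dist_triangle mY y (t j) y'; rewrite (dist_sym mY (t j) y'); lra.
Qed.

Lemma product_meas X Y (mu : set X -> R) (nu : set Y -> R) :
  is_meas (@mm_dist R X) mu -> is_meas (@mm_dist R Y) nu ->
  exists rho, [/\ is_meas (@prod_dist R X Y) rho &
   forall A B, borel (@mm_dist R X) A -> borel (@mm_dist R Y) B ->
     rho (A `*` B) = mu A * nu B].
Proof.
move=> mmu mnu; pose x0 := point_of X; pose y0 := point_of Y.
pose m1 : {finite_measure set (borel_space (@mm_dist R X) x0) -> \bar R} :=
  @emeas _ _ _ x0 _ mmu.
pose m2 : {finite_measure set (borel_space (@mm_dist R Y) y0) -> \bar R} :=
  @emeas _ _ _ y0 _ mnu.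
pose m : {measure set _ -> \bar R} := (m1 \x m2)%E.
have mE (A : set X) (B : set Y) : borel (@mm_dist R X) A -> borel (@mm_dist R Y) B ->
    m (A `*` B) = (mu A * nu B)%:E.
  move=> bA bB; rewrite /m /= product_measure1E// /m1 /m2 /= !emeasE//.
have mT : m setT = (mu setT * nu setT)%:E by rewrite -setXTT mE//; exact: borelT.
have fm C : borel (@prod_dist R X Y) C -> m C \is a fin_num.
  move=> bC; rewrite ge0_fin_numE//.
  have h : (m C <= m setT)%E.
    by apply: le_measure => //; rewrite inE; [exact: borel_prod_measurable|exact: measurableT].
  by apply: le_lt_trans h _; rewrite mT ltry.
exists (fun C => fine (m C)); split; first split.
- by rewrite measure0.
- by move=> A bA; rewrite fine_ge0.
- move=> F bF dF; apply/sums_to_nneseries => [n|]; first by rewrite fine_ge0.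
  rewrite fineK; last by apply: fm; exact: borel_bigcup.
  rewrite measure_semi_bigcup//.
  + by apply: eq_eseriesr => n _; rewrite fineK//; exact: fm.
  + by move=> n; exact: borel_prod_measurable.
  + by apply/trivIsetP => i j _ _ /eqP; exact: dF.
  + by apply: borel_prod_measurable; exact: borel_bigcup.
- by move=> A B bA bB; rewrite mE.
Qed.

(* The missing mass is distributed by the product of the defects of the two
   marginals. *)
Lemma complete_coupling X Y (theta : set (X * Y) -> R) :
  is_meas (@prod_dist R X Y) theta ->
  (forall A, borel (@mm_dist R X) A -> theta (A `*` setT) <= mm_meas A) ->
  (forall B, borel (@mm_dist R Y) B -> theta (setT `*` B) <= mm_meas B) ->
  exists pi, coupling pi /\
    forall C, borel (@prod_dist R X Y) C -> theta C <= pi C.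
Proof.
move=> mth leX leY.
have [muX X1] := (iffLR (is_prob_measureP _ _) (mm_prob X)).
have [muY Y1] := (iffLR (is_prob_measureP _ _) (mm_prob Y)).
have tX : is_meas (@mm_dist R X) (fun A => theta (A `*` setT)).
  have := is_meas_pushforward mth (@bmeasurable_fst X Y).
  by under eq_fun do rewrite -setXT_fst.
have tY : is_meas (@mm_dist R Y) (fun B => theta (setT `*` B)).
  have := is_meas_pushforward mth (@bmeasurable_snd X Y).
  by under eq_fun do rewrite -setTX_snd.
have m1 := is_measB muX tX leX; have m2 := is_measB muY tY leY.
(* Both marginal defects have total mass [t], so their product divided by [t] has them as marginals;
   when [t = 0] both defects vanish and [theta] is already a coupling. *)
pose t := 1 - theta setT.
have r1T : mm_meas [set: X] - theta (setT `*` setT) = t by rewrite setXTT X1.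
have r2T : mm_meas [set: Y] - theta (setT `*` setT) = t by rewrite setXTT Y1.
have bXT := @borelT R X (@mm_dist R X); have bYT := @borelT R Y (@mm_dist R Y).
have t0 : 0 <= t by rewrite -r1T; exact: meas_ge0 m1 _ bXT.
have [tz|tnz] := eqVneq t 0.
  exists theta; split=> //; split.
  - by apply/is_prob_measureP; split => //; move: tz; rewrite /t; lra.
  - move=> A bA; have := meas_le m1 bA bXT (@subsetT _ A).
    by have := meas_ge0 m1 bA; rewrite r1T tz; lra.
  - move=> B bB; have := meas_le m2 bB bYT (@subsetT _ B).
    by have := meas_ge0 m2 bB; rewrite r2T tz; lra.
have [rho [mrho rhoE]] := product_meas m1 m2.
have it0 : 0 <= t^-1 by rewrite invr_ge0.
have mZ := is_measZ it0 mrho.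
exists (fun C => theta C + t^-1 * rho C); split; last first.
  by move=> C bC; rewrite lerDl; exact: meas_ge0 mZ _ bC.
split.
- apply/is_prob_measureP; split; first exact: is_measD.
  by rewrite -{2}setXTT rhoE// r1T r2T mulKf// /t; lra.
- by move=> A bA; rewrite rhoE// r2T mulrC mulfK//; lra.
- by move=> B bB; rewrite rhoE// r1T mulKf//; lra.
Qed.

Lemma box_le X Y (pi : set (X * Y) -> R) S (e : R) : coupling pi ->
  borel (@prod_dist R X Y) S ->
  (forall p q, S p -> S q -> `|mm_dist p.1 q.1 - mm_dist p.2 q.2| <= e) ->
  1 - pi S <= e -> (box X Y <= e%:E)%E.
Proof.
move=> cpi bS dS pS; apply: ereal_inf_le.
exists (maxe (dis S) (1 - pi S)%:E); first by exists pi => //; exists S.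
rewrite ge_max lee_fin pS andbT; apply: ge_ereal_sup => _ [p Sp [q Sq <-]].
by rewrite lee_fin dS.
Qed.

Lemma box_ltP X Y (e : R) : (box X Y < e%:E)%E -> exists pi S,
  [/\ coupling pi, borel (@prod_dist R X Y) S,
   (forall p q, S p -> S q -> `|mm_dist p.1 q.1 - mm_dist p.2 q.2| < e) &
   1 - e < pi S].
Proof.
move/ereal_inf_lt => [_ [pi /= cpi [S bS <-]]].
rewrite gt_max lte_fin => /andP[dS pS]; exists pi, S; split => //; last by lra.
move=> p q Sp Sq; rewrite -lte_fin; apply: le_lt_trans dS.
by apply: ereal_sup_ubound; exists p => //; exists q.
Qed.

Lemma box_ge0 X Y : (0 <= box X Y)%E.
Proof.
apply: le_ereal_inf_tmp => _ [pi /= [mpi _ _] [S bS <-]].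
rewrite le_max; apply/orP; right; rewrite lee_fin subr_ge0.
have [mm <-] := (iffLR (is_prob_measureP _ _) mpi).
by apply: (meas_le mm bS) => //; exact: borelT.
Qed.

(** The image of the measure under the diagonal map is a coupling carried by the diagonal, a closed
    set of distortion zero. *)
Lemma box_xx X : box X X = 0%E.
Proof.
apply/eqP; rewrite eq_le box_ge0 andbT.
have mX := mm_metric X.
have mdiag : bmeasurable (@mm_dist R X) (@prod_dist R X X) (fun x => (x, x)).
  by apply: lipschitz_bmeasurable => x y; rewrite /prod_dist /= maxxx.
have cpi : coupling (fun C : set (X * X) => mm_meas ((fun x => (x, x)) @^-1` C)).
  split.
  - exact: (is_prob_pushforward (mm_prob X) mdiag).
  - by move=> A bA; congr mm_meas; apply/seteqP; split=> [x []|x].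
  - by move=> A bA; congr mm_meas; apply/seteqP; split=> [x []|x].
pose S : set (X * X) := [set p | p.1 = p.2].
have bS : borel (@prod_dist R X X) S.
  apply: borel_closed => -[x y] /= xy.
  have d0 : 0 < mm_dist x y.
    by rewrite lt_neqAle (dist_ge0 mX) eq_sym andbT; apply/eqP => /(dist_eq0 mX).
  exists (mm_dist x y / 2); first by rewrite divr_gt0.
  move=> [x' y']; rewrite /prod_dist /= gt_max => /andP[xx yy] e.
  have {}e : x' = y' := e.
  by have := dist_triangle mX x x' y; rewrite e (dist_sym mX y' y) in xx yy *; lra.
apply: (@box_le _ _ _ S _ cpi bS).
- by move=> p q; rewrite /S /= => -> ->; rewrite subrr normr0.
- rewrite [X in mm_meas X](_ : _ = setT); last by apply/seteqP; split.
  by case: (mm_prob X) => _ -> _ _; rewrite subrr.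
Qed.

Lemma dominated_trans X Y Z : dominated X Y -> dominated Y Z -> dominated X Z.
Proof.
move=> [f [lf mf]] [g [lg mg]]; exists (f \o g); split.
  by move=> x x'; apply: le_trans (lf _ _) (lg _ _).
move=> B bB; rewrite comp_preimage mg ?mf//.
exact: (lipschitz_bmeasurable lf).
Qed.

End Products.

(** * Chains of spaces placed at distance [L] from each other *)

Lemma natr_dist_lt1 {R : realType} (i j : nat) : `|i%:R - j%:R : R| < 1 -> i = j.
Proof.
wlog ij : i j / (i <= j)%N => [wl|].
  by have [/wl|/ltnW /wl h] := leqP i j; [exact|rewrite distrC => /h].
rewrite distrC -natrB// normr_nat ltrn1 ltnS leqn0 subn_eq0 => ji.
by apply/eqP; rewrite eqn_leq ij.
Qed.

Section Chain.
Context {R : realType}.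
Variables (C : nat -> mmSpace R) (L : R).
Hypothesis L0 : 0 < L.

Definition chain : Type := {i : nat & mm_carrier (C i)}.

Definition chain_incl i (x : C i) : chain := existT _ i x.

Definition chain_retr k (z : chain) : C k := untag (point_of (C k)) id z.

Lemma chain_inclK i (x : C i) : chain_retr i (chain_incl x) = x.
Proof. by rewrite /chain_retr /untag; case: eqP => // e; rewrite (eq_axiomK e). Qed.

Lemma chain_retrK z : chain_incl (chain_retr (tag z) z) = z.
Proof. by case: z => i x /=; rewrite chain_inclK. Qed.

Lemma chain_retr_off k z : tag z != k -> chain_retr k z = point_of (C k).
Proof. by move=> zk; rewrite /chain_retr untag_dflt. Qed.

(* The metric induced from the sup metric by [z |-> (L * tag z, (chain_retr k z)_k)];
   all the coordinates other than [tag z] and [tag z'] agree on [z] and [z']. *)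
Definition chain_dist (z z' : chain) : R :=
  Num.max `|L * (tag z)%:R - L * (tag z')%:R|
    (Num.max (mm_dist (chain_retr (tag z) z) (chain_retr (tag z) z'))
             (mm_dist (chain_retr (tag z') z) (chain_retr (tag z') z'))).

Lemma chain_height_lip z z' : `|L * (tag z)%:R - L * (tag z')%:R| <= chain_dist z z'.
Proof. by rewrite /chain_dist le_max lexx. Qed.

(** If [k] is the tag of neither point, both retract to the base point; otherwise the coordinate [k]
    occurs in the maximum defining [chain_dist]. *)
Lemma chain_retr_lip k z z' :
  mm_dist (chain_retr k z) (chain_retr k z') <= chain_dist z z'.
Proof.
have [<-|zk] := eqVneq (tag z) k; first by rewrite /chain_dist !le_max lexx orbT.
have [<-|zk'] := eqVneq (tag z') k; first by rewrite /chain_dist !le_max lexx !orbT.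
rewrite !chain_retr_off// (dist_xx (mm_metric _)).
by apply: le_trans (chain_height_lip z z').
Qed.

Lemma chain_dist_incl i (x y : C i) :
  chain_dist (chain_incl x) (chain_incl y) = mm_dist x y.
Proof.
rewrite /chain_dist /= subrr normr0 !chain_inclK maxxx.
by apply/max_idPr; exact: dist_ge0 (mm_metric _) _ _.
Qed.

(** Heights on different components differ by at least [L]; hence components are open, and Cauchy
    sequences settle in one of them. *)
Lemma chain_tag_eq z z' : chain_dist z z' < L -> tag z = tag z'.
Proof.
move=> h; have {h} : `|L * (tag z)%:R - L * (tag z')%:R| < L.
  exact: le_lt_trans (chain_height_lip z z') h.
by rewrite -mulrBr normrM (gtr0_norm L0) gtr_pMr// => /natr_dist_lt1.
Qed.

Lemma chain_dist_metric : is_metric chain_dist.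
Proof.
split.
- move=> z z'; split=> [h|->]; last first.
    by rewrite /chain_dist subrr normr0 (dist_xx (mm_metric _)) !maxxx.
  have e : tag z = tag z' by apply: chain_tag_eq; rewrite h.
  rewrite -(chain_retrK z) -(chain_retrK z') -e; congr chain_incl.
  apply: (dist_eq0 (mm_metric _)); apply/eqP.
  by rewrite eq_le (dist_ge0 (mm_metric _)) andbT -h chain_retr_lip.
- move=> z z'; rewrite /chain_dist distrC; congr Num.max.
  by rewrite maxC; congr Num.max; rewrite (dist_sym (mm_metric _)).
- move=> z z' z''; rewrite [leLHS]/chain_dist !ge_max; apply/and3P; split.
  + rewrite (le_trans (ler_distD (L * (tag z')%:R) _ _))//.
    by rewrite lerD ?chain_height_lip.
  + rewrite (le_trans (dist_triangle (mm_metric _) _ (chain_retr (tag z) z') _))//.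
    by rewrite lerD ?chain_retr_lip.
  + rewrite (le_trans (dist_triangle (mm_metric _) _ (chain_retr (tag z'') z') _))//.
    by rewrite lerD ?chain_retr_lip.
Qed.

Lemma chain_complete : is_complete chain_dist.
Proof.
move=> u cu; have [N hN] := cu L L0; pose i := tag (u N).
have tagu n : (N <= n)%N -> tag (u n) = i.
  by move=> Nn; apply/esym/chain_tag_eq; exact: hN.
have [x hx] : exists x : C i, forall e : R, 0 < e -> exists N, forall n,
    (N <= n)%N -> mm_dist (chain_retr i (u n)) x < e.
  apply: mm_complete => e /cu[M hM]; exists M => m n Mm Mn.
  by apply: le_lt_trans (hM _ _ Mm Mn); exact: chain_retr_lip.
exists (chain_incl x) => e /hx[M hM]; exists (maxn N M) => n.
rewrite geq_max => /andP[Nn Mn]; rewrite -(chain_retrK (u n)) (tagu n Nn).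
by rewrite chain_dist_incl hM.
Qed.

Lemma chain_separable : is_separable chain_dist.
Proof.
pose s i := projT1 (cid (mm_separable (C i))).
have hs i := projT2 (cid (mm_separable (C i))).
exists (fun n => if unpickle n is Some (i, j) then chain_incl (s i j)
  else chain_incl (s 0%N 0%N)) => z e e0.
have [j hj] := hs (tag z) (chain_retr (tag z) z) e e0.
exists (pickle (tag z, j)); rewrite pickleK -{1}(chain_retrK z).
by rewrite chain_dist_incl.
Qed.

Lemma chain_incl_bmeasurable i :
  bmeasurable (@mm_dist R (C i)) chain_dist (@chain_incl i).
Proof. by apply: lipschitz_bmeasurable => x y; rewrite chain_dist_incl. Qed.

Lemma chain_retr_bmeasurable i :
  bmeasurable chain_dist (@mm_dist R (C i)) (@chain_retr i).
Proof. by apply: lipschitz_bmeasurable => x y; exact: chain_retr_lip. Qed.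

Lemma borel_chain_tag i : borel chain_dist [set z | tag z = i].
Proof.
by apply: borel_open => z /= zi; exists L => // z' /chain_tag_eq <-.
Qed.

Variable w : nat -> R.
Hypotheses (w0 : forall i, 0 <= w i) (w1 : sums_to Inf w 1).

(** The extended-real series gives a value to every [B]; on Borel sets it is dominated by the series
    of the weights, so [fine] loses nothing there. *)
Definition chain_meas (B : set chain) : R :=
  fine (\sum_(0 <= i <oo) (w i * mm_meas (@chain_incl i @^-1` B))%:E)%E.

Let wm_ge0 B i : borel chain_dist B -> 0 <= w i * mm_meas (@chain_incl i @^-1` B).
Proof.
move=> bB; rewrite mulr_ge0//; apply: (meas_ge0 (prob_meas (mm_prob _))).
exact: chain_incl_bmeasurable.
Qed.

Lemma chain_meas_sums_to B : borel chain_dist B ->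
  sums_to Inf (fun i => w i * mm_meas (@chain_incl i @^-1` B)) (chain_meas B).
Proof.
move=> bB; have h i := wm_ge0 i bB.
have [s hs] : exists s, sums_to Inf (fun i => w i * mm_meas (@chain_incl i @^-1` B)) s.
  apply: (@sums_to_exists _ _ 1) => // k.
  apply: le_trans (sums_to_le w0 w1 k); apply: ler_sum => i _.
  rewrite ler_piMr//; have [m <-] := iffLR (is_prob_measureP _ _) (mm_prob (C i)).
  apply: (meas_le m) => //; [exact: chain_incl_bmeasurable|exact: borelT].
by rewrite /chain_meas (iffLR (sums_to_nneseries s h) hs).
Qed.

(** Countable additivity amounts to interchanging two series of nonnegative terms. *)
Lemma chain_meas_prob : is_prob_measure chain_dist chain_meas.
Proof.
have mC i := prob_meas (mm_prob (C i)).
have cmE B : borel chain_dist B ->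
    (\sum_(0 <= i <oo) (w i * mm_meas (@chain_incl i @^-1` B))%:E = (chain_meas B)%:E)%E.
  move=> bB; apply/(sums_to_nneseries _ (fun i => wm_ge0 i bB)).
  exact: chain_meas_sums_to.
have cm_ge0 B : borel chain_dist B -> 0 <= chain_meas B.
  by move=> bB; exact: sums_to_ge0 (fun i => wm_ge0 i bB) (chain_meas_sums_to bB).
split => //.
- apply: (sums_to_unique (chain_meas_sums_to (@borel0 _ _ _))).
  rewrite (_ : (fun i => _) = fun _ => 0); last first.
    by apply/funext => i; case: (mC i) => m0 _ _; rewrite preimage_set0 m0 mulr0.
  by have := @sums_to_finite R (fun _ => 0) 0; rewrite big_ord0; apply.
- apply: (sums_to_unique (chain_meas_sums_to (@borelT _ _ _))).
  rewrite (_ : (fun i => _) = w)//; apply/funext => i.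
  by rewrite preimage_setT; case: (mm_prob (C i)) => _ -> _ _; rewrite mulr1.
- move=> F bF dF; apply/sums_to_nneseries => [n|]; first exact: cm_ge0.
  rewrite -cmE; last exact: borel_bigcup.
  under eq_eseriesr do rewrite -cmE//.
  rewrite nneseries_interchange; last by move=> i j; rewrite lee_fin wm_ge0.
  apply: eq_eseriesr => i _; apply/(sums_to_nneseries _ (fun n => wm_ge0 i (bF n))).
  apply: sums_toZ; rewrite preimage_bigcup; have [_ _] := mC i; apply.
  + by move=> n; exact: chain_incl_bmeasurable.
  + by move=> n m nm; rewrite -preimage_setI dF// preimage_set0.
Qed.

Lemma chain_meas_component i (A : set (C i)) : borel (@mm_dist R (C i)) A ->
  chain_meas (chain_retr i @^-1` A `&` [set z | tag z = i]) = w i * mm_meas A.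
Proof.
move=> bA; have bB : borel chain_dist (chain_retr i @^-1` A `&` [set z | tag z = i]).
  by apply: borelI (borel_chain_tag i); exact: chain_retr_bmeasurable.
apply: (sums_to_unique (chain_meas_sums_to bB)).
set u := fun j => _.
have ui : u i = w i * mm_meas A.
  rewrite /u; congr (_ * mm_meas _); apply/seteqP; split=> x /=.
    by rewrite chain_inclK => -[].
  by rewrite chain_inclK.
have uj j : j != i -> u j = 0.
  move=> ji; rewrite /u (_ : _ @^-1` _ = set0).
    by case: (prob_meas (mm_prob (C j))) => -> _ _; rewrite mulr0.
  by apply/seteqP; split=> // x [_ /= /eqP]; rewrite (negbTE ji).
rewrite -ui (_ : u i = \sum_(j < i.+1) u j).
  apply: sums_to_finite => n lt; apply: uj; by rewrite gtn_eqF.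
rewrite big_ord_recr /= big1 ?add0r// => j _; apply: uj.
by rewrite ltn_eqF.
Qed.

Definition chain_space : mmSpace R :=
  MMSpace chain_dist_metric chain_complete chain_separable chain_meas_prob.

End Chain.

(** * Decompositions of chains *)

Section Decompositions.
Context {R : realType}.

Definition with_meas (X : mmSpace R) (nu : set X -> R)
  (h : is_prob_measure (@mm_dist R X) nu) : mmSpace R :=
  MMSpace (mm_metric X) (@mm_complete R X) (mm_separable X) h.

(** A one-sided form of membership in a direct sum: the partial sums only have to lie below the
    measure, so the mass of the full pyramid can be left out. The space [X'] absorbs the passage to
    an isomorphic copy, and [nu m] is constrained only where [b m] is positive. *)
Definition decomposed (b : nat -> R) (Q : nat -> @mmpred R) (X : mmSpace R) : Prop :=
  exists2 X' : mmSpace R, box X X' = 0%E & exists nu : nat -> set X' -> R,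
    (forall m, 0 < b m -> exists h, Q m (@with_meas X' (nu m) h)) /\
    forall B, borel (@mm_dist R X') B ->
      forall K : nat, \sum_(m < K) b m * nu m B <= mm_meas B.

(** A McShane-type extension: [g y] is the infimum of [f p.1 + mm_dist y p.2] over [p] in [S].
    Nonnegativity of [f] bounds it below, the choice of [p] itself gives [g p.2 <= f p.1], and the
    distortion costs at most [e] in the other direction. *)
Lemma lipschitz_transfer (X Y : mmSpace R) (S : set (X * Y)) (e : R) (f : X -> R) :
  S !=set0 -> (forall x, 0 <= f x) ->
  (forall x x', `|f x - f x'| <= mm_dist x x') ->
  (forall p q, S p -> S q -> `|mm_dist p.1 q.1 - mm_dist p.2 q.2| < e) ->
  exists g : Y -> R, (forall y y', `|g y - g y'| <= mm_dist y y') /\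
    forall p, S p -> `|f p.1 - g p.2| <= e.
Proof.
move=> [p0 Sp0] f0 lf dS; have mY := mm_metric Y.
pose V y := [set f p.1 + mm_dist y p.2 | p in S].
have V0 y : has_inf (V y).
  split; first by exists (f p0.1 + mm_dist y p0.2); exists p0.
  by exists 0 => _ [p _ <-]; rewrite addr_ge0// (dist_ge0 mY).
pose g y := inf (V y).
have gle y p : S p -> g y <= f p.1 + mm_dist y p.2.
  by move=> Sp; apply: ge_inf; [case: (V0 y)|exists p].
have gge y c : (forall p, S p -> c <= f p.1 + mm_dist y p.2) -> c <= g y.
  by move=> h; apply: lb_le_inf; [case: (V0 y)|move=> _ [p Sp <-]; exact: h].
have gl y y' : g y <= g y' + mm_dist y y'.
  rewrite -lerBlDr; apply: gge => p Sp; have := gle y p Sp.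
  by have := dist_triangle mY y y' p.2; lra.
exists g; split=> [y y'|p Sp].
  rewrite ler_norml; have := gl y y'; have := gl y' y.
  by rewrite (dist_sym mY y' y) => *; apply/andP; split; lra.
have g1 := gle p.2 p Sp; rewrite (dist_xx mY) in g1.
have g2 : f p.1 - e <= g p.2.
  apply: gge => q Sq; have := dS _ _ Sp Sq; have := lf p.1 q.1.
  by rewrite ler_norml ltr_norml => /andP[h1 h2] /andP[h3 h4]; lra.
by rewrite ler_norml; apply/andP; split; lra.
Qed.

(** The partial diameter is an infimum that need not be attained, whence the slack [1]. *)
Lemma obsdiam_concentration (Q : @mmpred R) (X : mmSpace R) (f : X -> R) (k D : R) :
  Q X -> (ObsDiamP Q k <= D%:E)%E ->
  (forall x x', `|f x - f x'| <= mm_dist x x') ->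
  exists A : set R, [/\ borel (@rdist R) A, 1 - k <= mm_meas (f @^-1` A) &
    forall x y, A x -> A y -> `|x - y| <= D + 1].
Proof.
move=> QX QD lf.
have h : (partial_diam f k < (D + 1)%:E)%E.
  apply: (@le_lt_trans _ _ D%:E); last by rewrite lte_fin ltrDl.
  apply: le_trans QD; apply: (@le_trans _ _ (ObsDiam X k)).
    by apply: ereal_sup_ubound; exists f.
  by apply: ereal_sup_ubound; exists X.
have [_ [A [bA mA] <-] dA] := ereal_inf_lt h.
exists A; split=> // x y Ax Ay; rewrite -lee_fin; apply: le_trans (ltW dA).
by apply: ereal_sup_ubound; exists x => //; exists y.
Qed.

Lemma lipschitz_real_bmeasurable (X : mmSpace R) (f : X -> R) :
  (forall x x', `|f x - f x'| <= mm_dist x x') ->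
  bmeasurable (@mm_dist R X) (@rdist R) f.
Proof. by move=> lf; exact: lipschitz_bmeasurable. Qed.

Lemma is_open_near (c e : R) : is_open (@rdist R) [set x | `|x - c| < e].
Proof.
move=> x /= xc; exists (e - `|x - c|); first by rewrite subr_gt0.
move=> y; rewrite /rdist /= => xy; have := ler_distD x y c.
by rewrite (distrC y x); lra.
Qed.

(** * Reading a decomposition of a chain through an almost isometric coupling *)

Section ChainDecomposition.
Variables (C : nat -> mmSpace R) (L : R) (L0 : 0 < L) (w : nat -> R).
Hypotheses (w0 : forall i, 0 <= w i) (w1 : sums_to Inf w 1).
Variables (b : nat -> R) (Q : nat -> @mmpred R) (K : nat) (k bmin D : R).
Hypotheses (b0 : forall m, 0 <= b m) (b1 : forall n, \sum_(m < n) b m <= 1).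
Hypotheses (k0 : 0 < k) (k1 : k <= 1 / 8) (bmin0 : 0 < bmin) (bmin1 : bmin <= 1).
Hypothesis bminP : forall m, (m < K)%N -> 0 < b m -> bmin <= b m.
Hypothesis D0 : 0 <= D.
Hypothesis QD : forall m, (m < K)%N -> 0 < b m -> (ObsDiamP (Q m) k <= D%:E)%E.
Hypothesis DL : D + 2 < L.

Let Z := chain_space C L0 w0 w1.
(** Measured against any positive [b m] with [m < K], mass [e] is at most the fraction [k]; this
    turns bounds on [mm_meas] into bounds on [nu m]. *)
Let e := k * bmin.

Let e0 : 0 < e. Proof. by rewrite mulr_gt0. Qed.

Let ek : e <= k. Proof. by rewrite ler_piMr// ltW. Qed.

Variables (Z' : mmSpace R) (nu : nat -> set Z' -> R).
Hypothesis nuQ : forall m, 0 < b m -> exists h, Q m (@with_meas Z' (nu m) h).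
Hypothesis nuS : forall B, borel (@mm_dist R Z') B ->
  forall K : nat, \sum_(m < K) b m * nu m B <= mm_meas B.

Variables (pi : set (Z * Z') -> R) (S : set (Z * Z')).
Hypotheses (cpi : coupling pi) (bS : borel (@prod_dist R Z Z') S).
Hypothesis dS : forall p q, S p -> S q ->
  `|mm_dist p.1 q.1 - mm_dist p.2 q.2| < e.
Hypothesis piS : 1 - e < pi S.

Variable g : Z' -> R.
Hypothesis lg : forall y y', `|g y - g y'| <= mm_dist y y'.
Hypothesis gS : forall p : Z * Z', S p -> `|L * (tag p.1)%:R - g p.2| <= e.

(** The half-width [1 / 2] exceeds the error [e <= 1 / 8] of [g] on [S], and [L > 2] keeps distinct
    levels disjoint. *)
Definition near_level (i : nat) : set Z' := [set y | `|g y - L * i%:R| < 1 / 2].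

Let N := near_level.

Let mpi : is_meas (@prod_dist R Z Z') pi.
Proof. by case: cpi => /prob_meas. Qed.

Let pi2 B : borel (@mm_dist R Z') B -> pi (snd @^-1` B) = mm_meas B.
Proof. by case: cpi => _ _ h /h; rewrite setTX_snd. Qed.

Let pi1 A : borel (@mm_dist R Z) A -> pi (fst @^-1` A) = mm_meas A.
Proof. by case: cpi => _ h _ /h; rewrite setXT_fst. Qed.

Let pi_setC : pi (~` S) < e.
Proof.
have := meas_setC mpi bS; have : pi setT = 1 by case: cpi => -[].
by move: piS; lra.
Qed.

Let bN i : borel (@mm_dist R Z') (N i).
Proof.
apply: (lipschitz_real_bmeasurable lg (B := [set x | `|x - L * i%:R| < 1 / 2])).
by apply: borel_open; exact: is_open_near.
Qed.

Let levels_eq (i j : nat) : `|L * i%:R - L * j%:R| < L -> i = j.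
Proof. by rewrite -mulrBr normrM (gtr0_norm L0) gtr_pMr// => /natr_dist_lt1. Qed.

Let nu_meas m : 0 < b m -> is_meas (@mm_dist R Z') (nu m).
Proof. by move=> bm; have [h _] := nuQ bm; exact: prob_meas. Qed.

Let b_nu_ge0 m B : borel (@mm_dist R Z') B -> 0 <= b m * nu m B.
Proof.
move=> bB; have [bm|bm] := ltP 0 (b m).
  by rewrite mulr_ge0// (meas_ge0 (nu_meas bm)).
by rewrite (_ : b m = 0) ?mul0r//; apply/eqP; rewrite eq_le bm b0.
Qed.

Let nu_le m B : borel (@mm_dist R Z') B -> b m * nu m B <= mm_meas B.
Proof.
move=> bB; apply: le_trans (nuS bB m.+1); rewrite big_ord_recr /= lerDr.
by apply: sumr_ge0 => i _; exact: b_nu_ge0.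
Qed.

Let S_near p : S p -> N (tag p.1) p.2.
Proof.
move=> /gS; rewrite distrC => h; apply: le_lt_trans h _.
by have := ek; have := k1; lra.
Qed.

Let near_tag p i : S p -> N i p.2 -> tag p.1 = i.
Proof.
move=> /S_near; rewrite /N /near_level /= => h1 h2; apply: levels_eq.
have := ler_distD (g p.2) (L * (tag p.1)%:R) (L * i%:R).
by rewrite (distrC _ (g p.2)); move: DL D0; lra.
Qed.

(** The observable diameter confines all but [k] of [nu m] to a set where [g] varies by at most
    [D + 1]. Points outside all levels are matched only off [S], so [nu m] gives them at most [k].
    The remaining set is nonempty and too narrow to meet two levels. *)
Lemma concentrated m : (m < K)%N -> 0 < b m -> exists i, 1 - 2 * k <= nu m (N i).
Proof.
move=> mK bm; have [h Qm] := nuQ bm; have mm := nu_meas bm.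
have [A [bA mA dA]] := obsdiam_concentration Qm (QD mK bm) lg.
have {}mA : 1 - k <= nu m (g @^-1` A) := mA.
have bgA := lipschitz_real_bmeasurable lg bA.
pose NN := \bigcup_i N i.
have bNN : borel (@mm_dist R Z') NN by exact: borel_bigcup.
have bNC := borelC bNN.
have muN : mm_meas (~` NN) < e.
  rewrite -pi2//; apply: le_lt_trans pi_setC; apply: (meas_le mpi).
  - exact: bmeasurable_snd.
  - exact: borelC.
  - by move=> p pN Sp; apply: pN; exists (tag p.1) => //; exact: S_near.
have nuN : nu m (~` NN) <= k.
  rewrite -(ler_pM2l bm); apply: le_trans (nu_le m bNC) _; apply: le_trans (ltW muN) _.
  by rewrite /e mulrC ler_wpM2r// ?bminP// ltW.
have nuAN : 1 - 2 * k <= nu m (g @^-1` A `&` NN).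
  by have := meas_le_setI mm bgA bNN; lra.
have [y0 [Ay0 [i _ y0i]]] : (g @^-1` A `&` NN) !=set0.
  apply/set0P/eqP => e'; move: nuAN; rewrite e'.
  by case: mm => -> _ _; move: k1; lra.
exists i; apply: le_trans nuAN _; apply: (meas_le mm) => //; first exact: borelI.
(* Two half-widths and the spread of [A] add up to [D + 2], which is less than the spacing [L]. *)
move=> y [Ay [j _ yj]]; rewrite (_ : i = j)//; apply: levels_eq.
have := dA _ _ Ay0 Ay; move: y0i yj; rewrite /N /near_level /= => h1 h2 h3.
have := ler_distD (g y0) (L * i%:R) (L * j%:R).
have := ler_distD (g y) (g y0) (L * j%:R).
by rewrite (distrC _ (g y0)); move: DL; lra.
Qed.

(** Within [S], the level [i] is matched with the component [i], of mass [w i]; the rest has mass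
    below [e]. *)
Lemma level_mass i : mm_meas (N i) <= w i + e.
Proof.
have bsN := @bmeasurable_snd R Z Z' _ (bN i).
rewrite -pi2//; apply: le_trans (meas_le_setI mpi bsN bS) _.
apply: lerD; last exact: ltW pi_setC.
have bT := @borel_chain_tag R C L L0 i.
apply: (@le_trans _ _ (pi (fst @^-1` [set z : chain C | tag z = i]))).
  apply: (meas_le mpi); first exact: borelI.
    exact: (@bmeasurable_fst R Z Z').
  by move=> p [pN Sp]; exact: near_tag.
rewrite pi1//.
have := @chain_meas_component R C L L0 w w0 w1 i setT (@borelT _ _ _).
rewrite preimage_setT setTI; case: (mm_prob (C i)) => _ -> _ _; rewrite mulr1.
by move=> <-.
Qed.

(** The measure [b m * nu m] lifts to some [rho] below [pi]. Restricting [rho] to the component [i],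
    retracting it to [C i] and dividing by [b m] gives a partial coupling [theta] of [C i] and
    [nu m]; its first marginal is admissible precisely because [w i <= b m]. Completing it to a
    coupling gives the box bound. *)
Lemma component_close m i : (m < K)%N -> 0 < b m -> 1 - 2 * k <= nu m (N i) ->
  w i <= b m -> exists2 Y, Q m Y & (box (C i) Y <= (3 * k)%:E)%E.
Proof.
move=> mK bm nuN wb; have [h Qm] := nuQ bm; have mm := nu_meas bm.
exists (with_meas h) => //.
have bm0 := ltW bm.
have [rho [mrho rho_le rho_snd]] : exists rho,
    [/\ is_meas (@prod_dist R Z Z') rho,
      forall D, borel (@prod_dist R Z Z') D -> rho D <= pi D &
      forall B, borel (@mm_dist R Z') B -> rho (snd @^-1` B) = b m * nu m B].
  apply: (lift_dominated_measure (point_of Z, point_of Z') (@bmeasurable_snd R Z Z') mpi).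
    exact: is_measZ.
  by move=> B bB; rewrite pi2// nu_le.
pose T : set (Z * Z') := fst @^-1` [set z : chain C | tag z = i].
have bT : borel (@prod_dist R Z Z') T.
  by apply: (@bmeasurable_fst R Z Z'); exact: borel_chain_tag.
pose r (p : Z * Z') : C i * Z' := (chain_retr i p.1, p.2).
have mr : bmeasurable (@prod_dist R Z Z') (@prod_dist R (C i) Z') r.
  apply: lipschitz_bmeasurable => p q; rewrite /prod_dist ge_max; apply/andP; split.
    by apply: le_trans (chain_retr_lip L i p.1 q.1) _; rewrite le_max lexx.
  by rewrite le_max lexx orbT.
have ib0 : 0 <= (b m)^-1 by rewrite invr_ge0.
pose theta (D : set (C i * Z')) := (b m)^-1 * rho (r @^-1` D `&` T).
have mth : is_meas (@prod_dist R (C i) Z') theta.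
  exact: (is_measZ ib0 (is_meas_restrict_preimage mrho bT mr)).
have theta1 A : borel (@mm_dist R (C i)) A -> theta (A `*` setT) <= mm_meas A.
  move=> bA; rewrite /theta.
  have bA' : borel (@mm_dist R Z) (chain_retr i @^-1` A `&` [set z : chain C | tag z = i]).
    by apply: borelI (@borel_chain_tag R C L L0 i); exact: chain_retr_bmeasurable.
  have -> : r @^-1` (A `*` setT) `&` T =
      fst @^-1` (chain_retr i @^-1` A `&` [set z : chain C | tag z = i]).
    by apply/seteqP; split=> [[z z'] [[]]|[z z'] []].
  rewrite ler_pdivrMl//; apply: le_trans (rho_le _ _) _.
    exact: (@bmeasurable_fst R Z Z').
  rewrite pi1//.
  have := chain_meas_component L0 w0 w1 bA; rewrite {1}/mm_meas /= => ->.
  by rewrite ler_wpM2r// (meas_ge0 (prob_meas (mm_prob _))).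
have theta2 B : borel (@mm_dist R Z') B -> theta (setT `*` B) <= nu m B.
  move=> bB; rewrite /theta ler_pdivrMl// -rho_snd//; apply: (meas_le mrho).
  - apply: borelI => //; apply: mr; rewrite setTX_snd; exact: bmeasurable_snd.
  - exact: bmeasurable_snd.
  - by move=> p [[]].
have [pi' [cpi' pi'_ge]] := complete_coupling (Y := with_meas h) mth theta1 theta2.
(* On [T] the map [j] inverts [r], so pulling [S] back along [j] keeps its distortion. *)
pose j (p : C i * Z') : Z * Z' := (chain_incl p.1, p.2).
have mj : bmeasurable (@prod_dist R (C i) Z') (@prod_dist R Z Z') j.
  by apply: lipschitz_bmeasurable => p q; rewrite /prod_dist /= chain_dist_incl.
have bS' := mj _ bS.
apply: (box_le cpi' bS').
  move=> p q Sp Sq; have := dS Sp Sq; rewrite /= chain_dist_incl => h1.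
  by apply: ltW; apply: lt_le_trans h1 _; have := ek; move: k0; lra.
(* At most [2 * k] is lost outside the level [i], and at most [k] outside [S], because
   [e <= b m * k]. *)
have th_ge : 1 - 3 * k <= theta (j @^-1` S).
  rewrite /theta ler_pdivlMl//.
  have bsN := @bmeasurable_snd R Z Z' _ (bN i).
  have h1 : rho (snd @^-1` N i `&` S) <= rho (r @^-1` (j @^-1` S) `&` T).
    apply: (meas_le mrho); first exact: borelI.
      by apply: borelI => //; exact: mr.
    move=> p [pN Sp]; have pT := near_tag Sp pN; split=> //.
    suff pE : j (r p) = p by rewrite /preimage /= pE.
    by rewrite /j /r /= -pT chain_retrK -surjective_pairing.
  have := meas_le_setI mrho bsN bS; rewrite rho_snd//.
  have := rho_le _ (borelC bS); have := pi_setC.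
  have : b m * (1 - 2 * k) <= b m * nu m (N i) by rewrite ler_pM2l.
  have : e <= b m * k by rewrite /e mulrC ler_wpM2r ?bminP// ltW.
  by rewrite !mulrBr mulr1 (mulrCA _ 3) (mulrCA _ 2); lra.
by have := pi'_ge _ bS'; lra.
Qed.

(** Each [m] sent to [i] puts at least [b m * (1 - 2 * k)] on the level [i]. As the [b m] sum to at
    most [1], removing the factor costs [2 * k], and [level_mass] adds [e <= k]. *)
Lemma level_packing (psi : nat -> nat) :
  (forall m, (m < K)%N -> 0 < b m -> 1 - 2 * k <= nu m (N (psi m))) ->
  forall i, \sum_(m < K | psi m == i) b m <= w i + 3 * k.
Proof.
move=> hpsi i.
have h1 : \sum_(m < K | psi m == i) b m * (1 - 2 * k) <= w i + e.
  apply: le_trans (level_mass i); apply: le_trans (nuS (bN i) K).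
  rewrite big_mkcond /=; apply: ler_sum => m _.
  case: eqP => [<-|_]; last exact: b_nu_ge0.
  have [bm|bm] := ltP 0 (b m); first by rewrite ler_pM2l// hpsi.
  by rewrite (_ : b m = 0) ?mul0r//; apply/eqP; rewrite eq_le bm b0.
have h2 : \sum_(m < K | psi m == i) b m <= 1.
  apply: le_trans (b1 K); rewrite big_mkcond /=; apply: ler_sum => m _.
  by case: ifP.
move: h1 h2; rewrite -big_distrl /=; set t := \sum_(_ < _ | _) _ => h1 h2.
have : t * (2 * k) <= 2 * k by rewrite ler_piMl// mulr_ge0// ltW.
by have := ek; move: h1; rewrite mulrBr mulr1; lra.
Qed.

End ChainDecomposition.

(** Box distance zero provides a coupling of precision [k * bmin], along which the height of the
    chain is transferred to [Z']; [psi m] is the level on which [nu m] concentrates. *)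
Lemma chain_decomposition (C : nat -> mmSpace R) (L : R) (L0 : 0 < L) (w : nat -> R)
    (w0 : forall i, 0 <= w i) (w1 : sums_to Inf w 1)
    (b : nat -> R) (Q : nat -> @mmpred R) (K : nat) (k bmin D : R) :
  (forall m, 0 <= b m) -> (forall n, \sum_(m < n) b m <= 1) ->
  0 < k -> k <= 1 / 8 -> 0 < bmin -> bmin <= 1 ->
  (forall m, (m < K)%N -> 0 < b m -> bmin <= b m) ->
  0 <= D -> (forall m, (m < K)%N -> 0 < b m -> (ObsDiamP (Q m) k <= D%:E)%E) ->
  D + 2 < L -> decomposed b Q (chain_space C L0 w0 w1) ->
  exists psi : nat -> nat,
    (forall i, \sum_(m < K | psi m == i) b m <= w i + 3 * k) /\
    forall m, (m < K)%N -> 0 < b m -> w (psi m) <= b m ->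
      exists2 Y, Q m Y & (box (C (psi m)) Y <= (3 * k)%:E)%E.
Proof.
move=> b0 b1 k0 k1 bmin0 bmin1 bminP D0 QD DL [Z' boxZ [nu [nuQ nuS]]].
set Z := chain_space _ _ _ _ in boxZ.
have e0 : 0 < k * bmin by rewrite mulr_gt0.
have [pi [S [cpi bS dS piS]]] : exists pi S, [/\ coupling pi,
    borel (@prod_dist R Z Z') S,
    (forall p q, S p -> S q -> `|mm_dist p.1 q.1 - mm_dist p.2 q.2| < k * bmin) &
    1 - k * bmin < pi S].
  by apply: box_ltP; rewrite boxZ lte_fin.
have S0 : S !=set0.
  apply/set0P/eqP => SE; have pi0 : pi set0 = 0 by case: cpi => -[].
  move: piS; rewrite SE pi0.
  have : k * bmin <= k by rewrite ler_piMr// ltW.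
  by lra.
have [g [lg gS]] : exists g : Z' -> R, (forall y y', `|g y - g y'| <= mm_dist y y') /\
    forall p, S p -> `|L * (tag p.1)%:R - g p.2| <= k * bmin.
  apply: (lipschitz_transfer (f := fun z : Z => L * (tag z)%:R)) S0 _ _ dS.
  - by move=> z; rewrite mulr_ge0// ltW.
  - by move=> z z'; exact: chain_height_lip.
have conc m : (m < K)%N -> 0 < b m -> exists i, 1 - 2 * k <= nu m (near_level L g i).
  by move=> mK bm; exact: (concentrated b0 k0 k1 bmin1 bminP QD DL nuQ nuS cpi bS piS lg gS mK bm).
have /choice[psi hpsi] : forall m, exists i, (m < K)%N -> 0 < b m ->
    1 - 2 * k <= nu m (near_level L g i).
  move=> m.
  have [mK|] := ltnP m K; last by exists 0%N.
  have [bm|] := ltP 0 (b m); last by exists 0%N.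
  by have [i hi] := conc m mK bm; exists i.
exists psi; split.
  exact: (level_packing b0 b1 k0 k1 bmin1 D0 DL nuQ nuS cpi bS piS lg gS hpsi).
move=> m mK bm wm.
exact: (component_close b0 k0 k1 bmin1 bminP D0 DL nuQ nuS cpi bS dS piS lg gS mK bm (hpsi m mK bm) wm).
Qed.

End Decompositions.

(** * Packings of weights *)

Section Packing.
Context {R : realType}.
Implicit Types (a b : nat -> R) (P Q : nat -> @mmpred R) (X : nat -> mmSpace R).

(** The smallest of finitely many thresholds serves for all; the default [1] keeps it positive when
    [T] is empty. *)
Lemma uniform_small (T : finType) (F : T -> R -> Prop) :
  (forall t x y, F t x -> y <= x -> F t y) ->
  (forall t, exists2 x : R, 0 < x & F t x) ->
  exists2 x : R, 0 < x & forall t, F t x.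
Proof.
move=> Fle Fex; have /choice[f hf] : forall t, exists x, 0 < x /\ F t x.
  by move=> t; have [x x0 Fx] := Fex t; exists x.
exists (\big[Order.min/1]_t f t).
  by apply: lt_bigmin => // t _; case: (hf t).
by move=> t; apply: Fle (proj2 (hf t)) _; exact: bigmin_le_cond.
Qed.

Lemma positive_lower_bound b (K : nat) : exists2 x : R, 0 < x <= 1 &
  forall m, (m < K)%N -> 0 < b m -> x <= b m.
Proof.
have [||x x0 hx] := @uniform_small 'I_K (fun m x => x <= 1 /\ (0 < b m -> x <= b m)).
- by move=> m x y [x1 xb] yx; split=> [|/xb xm]; exact: le_trans yx _.
- move=> m; have [bm|bm] := ltP 0 (b m); last by exists 1 => //; split=> // /lt_le_trans/(_ bm); rewrite ltxx.
  by exists (Order.min 1 (b m)); [rewrite lt_min ltr01 bm|rewrite !ge_min !lexx orbT].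
- exists (Order.min x 1); first by rewrite lt_min x0 ltr01 ge_min lexx orbT.
  by move=> m mK /(proj2 (hx (Ordinal mK))) xb; rewrite ge_min xb.
Qed.

Lemma obsdiam_upper_bound b Q (K : nat) (k : R) : 0 < k < 1 ->
  (forall m, 0 < b m -> finite_obsdiam (Q m)) ->
  exists2 D : R, 0 <= D &
    forall m, (m < K)%N -> 0 < b m -> (ObsDiamP (Q m) k <= D%:E)%E.
Proof.
move=> k01 fin; elim: K => [|K [D D0 hD]]; first by exists 0.
have [bK|bK] := ltP 0 (b K); last first.
  exists D => // m; rewrite ltnS leq_eqVlt => /orP[/eqP->|/hD//].
  by move=> /lt_le_trans/(_ bK); rewrite ltxx.
have := fin K bK k k01; case E : (ObsDiamP (Q K) k) => [x| |] // _.
- exists (Order.max D x) => [|m]; first by rewrite le_max D0.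
  rewrite ltnS leq_eqVlt => /orP[/eqP->|mK bm].
    by rewrite E lee_fin le_max lexx orbT.
  by apply: le_trans (hD m mK bm) _; rewrite lee_fin le_max lexx.
- exists D => // m; rewrite ltnS leq_eqVlt => /orP[/eqP-> _|/hD//].
  by rewrite E leNye.
Qed.

(* The mass [1 - s] of the full pyramid is spread over [J] components, so that
   none of them is heavy. *)
Definition test_weight (J : nat) (s : R) a (i : nat) : R :=
  if (i < J)%N then (1 - s) / J%:R else a (i - J)%N.

Lemma test_weight_ge0 J s a : s <= 1 -> (forall n, 0 <= a n) ->
  forall i, 0 <= test_weight J s a i.
Proof.
move=> s1 a0 i; rewrite /test_weight; case: ifP => // _.
by rewrite divr_ge0// subr_ge0.
Qed.

Lemma test_weight_sum (J : nat) s a : (0 < J)%N -> sums_to Inf a s ->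
  sums_to Inf (test_weight J s a) 1.
Proof.
move=> J0 as_.
have -> : 1 = \sum_(i < J) test_weight J s a i + s.
  rewrite (eq_bigr (fun _ => (1 - s) / J%:R)); last first.
    by move=> i _; rewrite /test_weight ltn_ord.
  by rewrite sumr_const card_ord -[X in X + s]mulr_natr divfK ?pnatr_eq0 -?lt0n// subrK.
apply: sums_to_shift; rewrite (_ : (fun n => _) = a)//.
by apply/funext => n; rewrite /test_weight ltnNge leq_addr addKn.
Qed.

Definition packs b a (K : nat) (phi : nat -> nat) :=
  forall n, \sum_(m < K | phi m == n) b m <= a n.

Definition close_in X (Y : @mmpred R) n (eta : R) :=
  exists2 Z, Y Z & (box (X n) Z < eta%:E)%E.

(** The truncated subtraction [i - J] makes every light component a copy of [X 0]. [J] and [L] stay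
    free, to be chosen once the precision is known. *)
Definition test_decomposed a b Q X :=
  forall s (s1 : s <= 1) (a0 : forall n, 0 <= a n) (as_ : sums_to Inf a s)
    (J : nat) (J0 : (0 < J)%N) (L : R) (L0 : 0 < L),
  decomposed b Q (chain_space (fun i => X (i - J)%N) L0 (@test_weight_ge0 J s a s1 a0)
    (@test_weight_sum J s a J0 as_)).

Section Approx.
Variables (a b : nat -> R) (Q : nat -> @mmpred R) (X : nat -> mmSpace R) (s : R).
Hypotheses (a0 : forall n, 0 <= a n) (as_ : sums_to Inf a s) (s1 : s <= 1).
Hypotheses (b0 : forall n, 0 <= b n) (b1 : forall n, \sum_(m < n) b m <= 1).
Hypothesis Qfin : forall m, 0 < b m -> finite_obsdiam (Q m).
Hypothesis test : test_decomposed a b Q X.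

Lemma approx_packing (K : nat) (eta : R) : 0 < eta ->
  exists phi, packs b (fun n => a n + eta) K phi /\
    forall m, (m < K)%N -> 0 < b m -> a (phi m) = b m -> close_in X (Q m) (phi m) eta.
Proof.
move=> eta0.
have [bmin /andP[bmin0 bmin1] bminP] := positive_lower_bound b K.
(* The bound by [eta] keeps the error [3 * k] below [eta]; the bound by [bmin] keeps positive
   weights out of the light components. *)
pose k := Order.min eta bmin / 8.
have keta : k * 8 <= eta by rewrite /k divfK// ge_min lexx.
have kbmin : k * 8 <= bmin by rewrite /k divfK// ge_min lexx orbT.
have k0 : 0 < k by rewrite divr_gt0// lt_min eta0.
have k1 : k <= 1 / 8 by lra.
have k01 : 0 < k < 1 by rewrite k0 /=; lra.
have [D D0 QD] := obsdiam_upper_bound K k01 Qfin.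
have L0 : 0 < D + 3 by lra.
have DL : D + 2 < D + 3 by lra.
have [J Jlt] : exists J : nat, (1 - s) / J.+1%:R < bmin / 4.
  have h0 : 0 < bmin / 4 by rewrite divr_gt0.
  have [J /= _ /(_ J (leqnn J)) h] := near_infty_natSinv_lt (PosNum h0).
  exists J; apply: le_lt_trans h; rewrite /= ler_piMl ?invr_ge0//.
  by have := sums_to_ge0 a0 as_; lra.
have [psi [pack close]] := chain_decomposition b0 b1 k0 k1 bmin0 bmin1 bminP D0 QD DL
  (test s1 a0 as_ (ltn0Sn J) L0).
(* A light component has capacity below [bmin / 4 + 3 * k], hence below [bmin], and cannot hold
   [b m]. *)
have psiJ m : (m < K)%N -> 0 < b m -> (J.+1 <= psi m)%N.
  move=> mK bm; rewrite leqNgt; apply/negP => lt.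
  have := pack (psi m); rewrite /test_weight lt.
  rewrite (bigD1 (Ordinal mK)) ?eqxx//= => h.
  have h' : 0 <= \sum_(i < K | (psi i == psi m) && (i != Ordinal mK)) b i.
    by apply: sumr_ge0.
  move: ((1 - s) / _) Jlt h (bminP m mK bm) => q; lra.
(* The truncated subtraction is exact when [b m > 0] by [psiJ]; the other indices add nothing to the
   sums. *)
exists (fun m => psi m - J.+1)%N; split=> [n|m mK bm am].
- have := pack (J.+1 + n)%N; rewrite /test_weight ltnNge leq_addr addKn /=.
  move=> h; apply: le_trans (_ : a n + 3 * k <= _); last by lra.
  apply: le_trans h; rewrite !(big_mkcond (fun i : 'I_K => _ == _)) /=; apply: ler_sum => m _.
  have [bm|bm] := ltP 0 (b m); last first.
    by rewrite (_ : b m = 0) ?if_same//; apply/eqP; rewrite eq_le bm b0.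
  case: eqP => [<-|_]; last by case: ifP.
  by rewrite subnKC ?psiJ// eqxx.
- have tw : test_weight J.+1 s a (psi m) = b m.
    by rewrite /test_weight ltnNge psiJ.
  have [|Y QY hY] := close m mK bm; first by rewrite tw.
  by exists Y => //; apply: le_lt_trans hY _; rewrite lte_fin; lra.
Qed.

(** For a subset of positive sum [t], the weights [a n] are eventually below [t / 2], so
    [d <= t / 2] excludes all late bins and finitely many bins remain. There are finitely many
    subsets. This makes an approximate packing exact. *)
Lemma packing_gap (K : nat) : exists2 d : R, 0 < d &
  forall (F : {set 'I_K}) n, \sum_(m in F) b m <= a n + d -> \sum_(m in F) b m <= a n.
Proof.
apply: (@uniform_small {set 'I_K} (fun F d => forall n,
  \sum_(m in F) b m <= a n + d -> \sum_(m in F) b m <= a n)).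
  by move=> F x y h yx n hy; apply: h; apply: le_trans hy _; rewrite lerD2l.
move=> F; set t := \sum_(m in F) b m.
have [t0|t0] := leP t 0; first by exists 1 => // n _; exact: le_trans t0 (a0 n).
have /cvgr_lt/(_ (t / 2)) : a @ \oo --> (0 : R) by exact: sums_to_cvg0 as_.
rewrite divr_gt0// => /(_ isT)[n0 _ hn0].
have [||d d0 hd] := @uniform_small 'I_n0 (fun n d => t <= a n + d -> t <= a n).
- by move=> n x y h yx hy; apply: h; apply: le_trans hy _; rewrite lerD2l.
- move=> n; have [h|h] := leP t (a n); first by exists 1.
  by exists ((t - a n) / 2); [rewrite divr_gt0// subr_gt0|lra].
- exists (Order.min d (t / 2)); first by rewrite lt_min d0 divr_gt0.
  move=> n h; have [nn|nn] := ltnP n n0.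
    apply: (hd (Ordinal nn)); apply: le_trans h _.
    by rewrite lerD2l ge_min lexx.
  have /= := hn0 n nn; have : Order.min d (t / 2) <= t / 2 by rewrite ge_min lexx orbT.
  by lra.
Qed.

Lemma exact_packing (K : nat) (eta : R) : 0 < eta ->
  exists phi, packs b a K phi /\
    forall m, (m < K)%N -> 0 < b m -> a (phi m) = b m -> close_in X (Q m) (phi m) eta.
Proof.
move=> eta0; have [d d0 gap] := packing_gap K.
have m0 : 0 < Order.min d eta by rewrite lt_min d0.
have [phi [pack close]] := approx_packing K m0.
exists phi; split=> [n|m mK bm am].
- have := gap [set m : 'I_K | phi m == n]%SET n.
  rewrite (eq_bigl (fun m : 'I_K => phi m == n)); last by move=> m; rewrite inE.
  apply; apply: le_trans (pack n) _; by rewrite lerD2l ge_min lexx.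
- have [Y QY hY] := close m mK bm am; exists Y => //.
  by apply: lt_le_trans hY _; rewrite lee_fin ge_min lexx orbT.
Qed.

End Approx.
End Packing.

(** * Matching the components *)

Section Combinatorics.
Context {R : realType}.
Implicit Types (a b : nat -> R).

Lemma sum_fibers (K M : nat) (phi : nat -> nat) (u : nat -> R) :
  (forall j, (j < K)%N -> (phi j < M)%N) ->
  \sum_(n < M) \sum_(j < K | phi j == n) u j = \sum_(j < K) u j.
Proof.
move=> lt; rewrite (exchange_big_dep xpredT)//=; apply: eq_bigr => j _.
have h := lt j (ltn_ord j).
by rewrite (big_pred1 (Ordinal h)).
Qed.

Lemma packs_le a b (K : nat) phi : (forall n, 0 <= b n) -> packs b a K phi ->
  forall j, (j < K)%N -> b j <= a (phi j).
Proof.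
move=> b0 pack j jK; apply: le_trans (pack (phi j)).
by rewrite (bigD1 (Ordinal jK)) ?eqxx//= lerDl sumr_ge0.
Qed.

Lemma nonincreasing_leq a : (forall n, a n.+1 <= a n) ->
  forall m n, (m <= n)%N -> a n <= a m.
Proof.
move=> nia m n; elim: n => [|n IH]; first by rewrite leqn0 => /eqP->.
rewrite leq_eqVlt => /orP[/eqP->//|]; rewrite ltnS => /IH.
exact: le_trans.
Qed.

(** If [b m > a m], none of [b 0, ..., b m] fits into a bin of index at least [m], so all go into
    the first [m] bins. These have total capacity [b 0 + ... + b (m - 1)], which forces
    [b m <= 0]. *)
Lemma packs_step a b m phi : (forall n, a n.+1 <= a n) -> (forall n, b n.+1 <= b n) ->
  (forall n, 0 <= a n) -> (forall n, 0 <= b n) ->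
  (forall j, (j < m)%N -> a j = b j) -> packs b a m.+1 phi -> b m <= a m.
Proof.
move=> nia nib a0 b0 eqab pack; rewrite leNgt; apply/negP => lt.
have phi_lt j : (j < m.+1)%N -> (phi j < m)%N.
  move=> jm; rewrite ltnNge; apply/negP => mphi.
  have := packs_le b0 pack jm; have := nonincreasing_leq nia mphi.
  have : b m <= b j by apply: (nonincreasing_leq nib); rewrite -ltnS.
  by lra.
have : \sum_(j < m.+1) b j <= \sum_(n < m) a n.
  by rewrite -(sum_fibers b phi_lt); apply: ler_sum => n _; exact: pack.
have -> : \sum_(n < m) a n = \sum_(n < m) b n.
  by apply: eq_bigr => j _; exact: eqab.
rewrite big_ord_recr /=.
by have := a0 m; lra.
Qed.

(* Packing [b] into [a] alone does not give [b <= a] pointwise: two halves fit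
   into one unit.  Both directions are used at each step of the induction. *)
Lemma packs_antisym a b :
  (forall n, a n.+1 <= a n) -> (forall n, b n.+1 <= b n) ->
  (forall n, 0 <= a n) -> (forall n, 0 <= b n) ->
  (forall K, exists phi, packs b a K phi) ->
  (forall K, exists phi, packs a b K phi) -> a =1 b.
Proof.
move=> nia nib a0 b0 pba pab n.
elim/ltn_ind: n => n IH; apply/eqP; rewrite eq_le; apply/andP; split.
- have [phi pack] := pab n.+1.
  by apply: (packs_step nib nia b0 a0) pack => j /IH.
- have [phi pack] := pba n.+1.
  by apply: (packs_step nia nib a0 b0) pack => j /IH.
Qed.

(* A packing of [a] into itself fills each of the first [k] bins exactly as soon
   as [a] drops at [k], so it permutes them. *)
Lemma packs_self_perm a (k : nat) phi : (forall n, a n.+1 <= a n) ->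
  (forall n, 0 <= a n) -> (forall j, (j < k)%N -> a k < a j) -> packs a a k phi ->
  exists sigma : {ffun 'I_k -> 'I_k}, [/\ injective sigma,
    forall m, sigma m = phi m :> nat & forall m, a (sigma m) = a m].
Proof.
move=> nia a0 drop pack.
have phi_lt j : (j < k)%N -> (phi j < k)%N.
  move=> jk; rewrite ltnNge; apply/negP => kphi.
  have := packs_le a0 pack jk; have := nonincreasing_leq nia kphi.
  by have := drop j jk; lra.
pose sigma := [ffun m : 'I_k => Ordinal (phi_lt m (ltn_ord m))].
have sigmaE (m : 'I_k) : sigma m = phi m :> nat by rewrite ffunE.
(* The free capacities of the bins are nonnegative and sum to zero. *)
have full (n : 'I_k) : \sum_(j < k | phi j == n) a j = a n.
  have : \sum_(n < k) (a n - \sum_(j < k | phi j == n) a j) = 0.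
    by rewrite sumrB (sum_fibers a phi_lt) subrr.
  move/psumr_eq0P => /(_ _ n isT)/eqP; rewrite subr_eq0 => h.
  by apply/esym/eqP; apply: h => i _; rewrite subr_ge0.
(* An empty bin would have capacity zero, but [a n > a k >= 0]. *)
have surj (n : 'I_k) : exists m, sigma m = n.
  apply: contrapT => h; have := full n; rewrite big1 => [/esym an|j /eqP jn].
    by have := drop n (ltn_ord n); have := a0 k; lra.
  by exfalso; apply: h; exists j; apply: val_inj; rewrite /= sigmaE.
have /choice[g gK] := surj.
have ginj : injective g by exact: can_inj gK.
have sK : cancel sigma g by apply/(bij_can_sym (injF_bij ginj)).
have sinj := can_inj sK.
exists sigma; split=> // m.
(* By injectivity the bin [sigma m] contains only [m], and it is full. *)
rewrite -full (bigD1 m) ?sigmaE//= big1 ?addr0// => j /andP[/eqP jm] /eqP[].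
by apply: sinj; apply: val_inj; rewrite /= !sigmaE.
Qed.

End Combinatorics.

(** * From packings to inclusions and equalities of pyramids *)

Section Matching.
Context {R : realType}.
Implicit Types (P Q : nat -> @mmpred R).

(** Directedness is iterated over the finite index type, skipping the spaces outside the pyramid. *)
Lemma pyramid_dominating (T : finType) (p : @mmpred R) (X : T -> mmSpace R) :
  is_pyramid p -> exists2 W, p W & forall t, p (X t) -> dominated (X t) W.
Proof.
move=> [[W0 pW0] _ _ dir].
suff [W pW hW] : exists2 W, p W & forall t, t \in enum T -> p (X t) -> dominated (X t) W.
  by exists W => // t; apply: hW; rewrite mem_enum.
elim: (enum T) => [|t r [W pW hW]]; first by exists W0.
have [pt|npt] := pselect (p (X t)); last first.
  by exists W => // u; rewrite inE => /orP[/eqP->|/hW].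
have [V pV [tV WV]] := dir _ _ pt pW.
exists V => // u; rewrite inE => /orP[/eqP->//|ur pu].
exact: dominated_trans (hW _ ur pu) WV.
Qed.

Section Inclusions.
Variables (a : nat -> R) (P Q : nat -> @mmpred R) (k : nat).
Hypotheses (nia : forall n, a n.+1 <= a n) (a0 : forall n, 0 <= a n).
Hypothesis drop : forall j, (j < k)%N -> a k < a j.
Hypotheses (Ppyr : forall n, 0 < a n -> is_pyramid (P n)).
Hypotheses (Qpyr : forall n, 0 < a n -> is_pyramid (Q n)).
Hypothesis pack : forall X : nat -> mmSpace R,
  (forall n, 0 < a n -> P n (X n)) -> forall eta : R, 0 < eta ->
  exists phi, packs a a k phi /\
    forall m, (m < k)%N -> 0 < a m -> a (phi m) = a m -> close_in X (Q m) (phi m) eta.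

Let good (sigma : {ffun 'I_k -> 'I_k}) :=
  injective sigma /\ forall m, a (sigma m) = a m.

Let apos (m : 'I_k) : 0 < a m.
Proof. exact: le_lt_trans (a0 k) (drop (ltn_ord m)). Qed.

(* If no permutation worked, the spaces witnessing the failures of all of them
   would be dominated by a single family [W], and packing [W] at finer and finer
   scales would single out one permutation that works for [W]. *)
Lemma matching_inclusion : exists sigma : {ffun 'I_k -> 'I_k},
  good sigma /\ forall (m : 'I_k) X, P (sigma m) X -> Q m X.
Proof.
apply: contrapT => noperm.
have bad sigma : good sigma -> exists (m : 'I_k) X, P (sigma m) X /\ ~ Q m X.
  move=> gs; apply: contrapT => h; apply: noperm; exists sigma; split=> // m X PX.
  by apply: contrapT => nQ; apply: h; exists m, X.
(* With no index the empty permutation works; otherwise [P 0] is a pyramid and supplies the default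
   space [X0]. *)
have [k0|k0] := eqVneq k 0%N.
  have no (m : 'I_k) : False by case: m => m; rewrite k0 ltn0.
  apply: noperm; exists [ffun m : 'I_k => m]; split; last by move=> m; case: (no m).
  by split=> m; case: (no m).
have k0' : (0 < k)%N by rewrite lt0n.
have [X0 _] : exists X, P 0%N X by have [] := Ppyr (apos (Ordinal k0')).
have /choice[F hF] : forall sigma, exists F : 'I_k * mmSpace R,
    good sigma -> P (sigma F.1) F.2 /\ ~ Q F.1 F.2.
  move=> sigma; have [gs|ngs] := pselect (good sigma).
    by have [m [X h]] := bad sigma gs; exists (m, X).
  by exists (Ordinal k0', X0).
have /choice[W hW] : forall n, exists W, 0 < a n -> P n W /\
    forall sigma, P n (F sigma).2 -> dominated (F sigma).2 W.
  move=> n; have [an|] := ltP 0 (a n); last by exists X0.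
  by have [W PW h] := pyramid_dominating (fun sigma => (F sigma).2) (Ppyr an); exists W.
(* A single scale [eta] at which every good permutation fails for [W]. *)
have [||eta eta0 heta] := @uniform_small R {ffun 'I_k -> 'I_k}
  (fun sigma eta => good sigma -> ~ forall m : 'I_k, close_in W (Q m) (sigma m) eta).
- move=> sigma x y hx yx gs h; apply: (hx gs) => m; have [Z QZ hZ] := h m.
  by exists Z => //; apply: lt_le_trans hZ _; rewrite lee_fin.
- move=> sigma; apply: contrapT => h.
  have [gs|ngs] := pselect (good sigma); last by apply: h; exists 1.
  (* If [sigma] worked at every scale, closedness would put [W (sigma m)] in [Q m], and with it the
     dominated witness that was chosen outside [Q m]. *)
  have cl eta : 0 < eta -> forall m : 'I_k, close_in W (Q m) (sigma m) eta.
    by move=> eta0; apply: contrapT => h'; apply: h; exists eta.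
  have [PF nQF] := hF sigma gs; set m := (F sigma).1 in PF nQF.
  have [PW Wdom] := hW (sigma m) (apos (sigma m)).
  have [_ Qcl Qdown _] := Qpyr (apos m).
  apply: nQF; apply: Qdown (Wdom sigma PF); apply: Qcl => e e0.
  by have [Z QZ hZ] := cl e e0 m; exists Z.
- have PW n : 0 < a n -> P n (W n) by move=> /hW[].
  have [phi [pphi close]] := pack PW eta0.
  have [sigma [si sE sa]] := packs_self_perm nia a0 drop pphi.
  apply: (heta sigma) => // m; rewrite sE; apply: close => //.
  by rewrite -sE.
Qed.

End Inclusions.

(** Each step of [rho] maps backwards to an inclusion of pyramids, and the orbit of [m] under [rho]
    is a finite cycle. Going round it places [P m] inside [P (rho m)], hence inside [Q (tau m)]. *)
Lemma matching_block P Q (k : nat) (sigma tau : {ffun 'I_k -> 'I_k}) :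
  injective sigma -> injective tau ->
  (forall (m : 'I_k) X, P (sigma m) X -> Q m X) ->
  (forall (m : 'I_k) X, Q (tau m) X -> P m X) ->
  forall (m : 'I_k) X, P m X <-> Q (tau m) X.
Proof.
move=> si ti PQ QP m X; split; last exact: QP.
pose rho := sigma \o tau.
have ri : injective rho by exact: inj_comp.
have Prho (n : 'I_k) Y : P (rho n) Y -> P n Y by move=> /PQ/QP.
have Piter j (n : 'I_k) Y : P (iter j rho n) Y -> P n Y.
  by elim: j => //= j IH /Prho.
rewrite -{1}(iter_order ri m).
have := fingraph.order_gt0 rho m; case: (fingraph.order rho m) => // j _.
by rewrite iterSr => /Piter/PQ.
Qed.

End Matching.

(** * Direct sums as decompositions *)

Section DirectSums.
Context {R : realType}.
Implicit Types (u w : nat -> R) (P Q : nat -> @mmpred R).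

Lemma natbar_ext (N M : natbar) : (forall n, nlt n N <-> nlt n M) -> N = M.
Proof.
case: N M => [k|] [l|] //= h.
- congr Fin; apply/eqP; rewrite eqn_leq; apply/andP; split; rewrite leqNgt; apply/negP.
  + by move/(iffLR (h _)); rewrite ltnn.
  + by move/(iffRL (h _)); rewrite ltnn.
- by have := iffRL (h k) I; rewrite ltnn.
- by have := iffLR (h l) I; rewrite ltnn.
Qed.

(** Extension by zero lets finite and infinite families be handled as sequences on all of [nat]. *)
Definition zero_ext (K : natbar) u (i : nat) : R := if `[< nlt i K >] then u i else 0.

Lemma zero_extE K u i : nlt i K -> zero_ext K u i = u i.
Proof. by rewrite /zero_ext; case: asboolP. Qed.

Lemma zero_ext0 K u i : ~ nlt i K -> zero_ext K u i = 0.
Proof. by rewrite /zero_ext; case: asboolP. Qed.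

Lemma sums_to_zero_ext K u (s : R) : sums_to K u s <-> sums_to Inf (zero_ext K u) s.
Proof.
case: K => [k|].
  have h := @sums_to_finite R (zero_ext (Fin k) u) k.
  have e : \sum_(i < k) zero_ext (Fin k) u i = \sum_(i < k) u i.
    by apply: eq_bigr => i _; rewrite zero_extE//=.
  have {}h : sums_to Inf (zero_ext (Fin k) u) (\sum_(i < k) u i).
    by rewrite -e; apply: h => n kn; rewrite zero_ext0//=; apply/negP; rewrite -leqNgt.
  by split=> [<-//|us]; exact: sums_to_unique h us.
by rewrite (_ : zero_ext Inf u = u)//; apply/funext => i; rewrite zero_extE.
Qed.

Lemma zero_extM K u v i : zero_ext K (fun i => u i * v i) i = zero_ext K u i * v i.
Proof. by rewrite /zero_ext; case: ifP => // _; rewrite mul0r. Qed.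

(** The images of the summand measures serve as [nu]: [fs i] exhibits the image as dominated by
    [Xs i], so downward closure keeps it in [P i]. *)
Lemma dsum_decomposed K w P X : (forall i, nlt i K -> 0 <= w i) ->
  (forall i, nlt i K -> forall X Y, P i X -> dominated Y X -> P i Y) ->
  dsum K w P X -> decomposed (zero_ext K w) P X.
Proof.
move=> w0 Pdown [X' [box0 [Xs [fs [PXs [lfs sumX]]]]]]; exists X' => //.
exists (fun i B => mm_meas (fs i @^-1` B)); split=> [i|B bB k].
  have [iK _|iK] := pselect (nlt i K); last by rewrite zero_ext0// ltxx.
  have mf := lipschitz_bmeasurable (lfs i iK).
  have h := is_prob_pushforward (mm_prob (Xs i)) mf.
  exists h; apply: (Pdown i iK _ _ (PXs i iK)).
  by exists (fs i); split=> //; exact: lfs.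
have /sums_to_zero_ext h := sumX B bB.
have {}h : sums_to Inf (fun i => zero_ext K w i * mm_meas (fs i @^-1` B)) (mm_meas B).
  by rewrite [X in sums_to _ X](_ : _ = zero_ext K (fun i => w i * mm_meas (fs i @^-1` B)))//;
    apply/funext => i; rewrite zero_extM.
apply: (sums_to_le _ h) => i; have [iK|iK] := pselect (nlt i K); last first.
  by rewrite zero_ext0// mul0r.
rewrite zero_extE// mulr_ge0 ?w0//; apply: (meas_ge0 (prob_meas (mm_prob (Xs i)))).
exact: (lipschitz_bmeasurable (lfs i iK)).
Qed.

(** Dropping a nonnegative term preserves the one-sided bounds; this discards the summand of the
    full pyramid. *)
Lemma decomposed_tail (b : nat -> R) P X : (forall i, 0 <= b i) -> decomposed b P X ->
  decomposed (fun i => b i.+1) (fun i => P i.+1) X.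
Proof.
move=> b0 [X' box0 [nu [nuP nuS]]]; exists X' => //.
exists (fun i => nu i.+1); split=> [m|B bB K]; first exact: nuP.
apply: le_trans (nuS B bB K.+1); rewrite big_ord_recl /= lerDr.
have [bp|bn] := ltP 0 (b 0%N); last first.
  by rewrite (_ : b 0%N = 0) ?mul0r//; apply/eqP; rewrite eq_le bn b0.
by have [h _] := nuP _ bp; rewrite mulr_ge0// (meas_ge0 (prob_meas h)).
Qed.

Lemma dsum_intro K w P (X : mmSpace R) (Xs : nat -> mmSpace R) (fs : forall i, Xs i -> X) :
  (forall i, nlt i K -> P i (Xs i)) -> (forall i, nlt i K -> lip1 (fs i)) ->
  (forall B, borel (@mm_dist R X) B ->
    sums_to Inf (fun i => zero_ext K w i * mm_meas (fs i @^-1` B)) (mm_meas B)) ->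
  dsum K w P X.
Proof.
move=> PX lf sumX; exists X; split; first exact: box_xx.
exists Xs, fs; split=> //; split=> // B bB; apply/sums_to_zero_ext.
have := sumX B bB; congr sums_to; apply/funext => i.
by rewrite zero_extM.
Qed.

Definition weightA (A : @seqA R) : nat -> R := zero_ext (lenA A) (valA A).

Section WeightA.
Variable A : @seqA R.
Hypothesis iA : inA A.

Lemma weightA_gt0 n : 0 < weightA A n <-> nlt n (lenA A).
Proof.
split=> [|nA]; last first.
  by rewrite /weightA zero_extE//; case: iA => /(_ n nA)/andP[].
by move=> h; apply: contrapT => nA; move: h; rewrite /weightA zero_ext0// ltxx.
Qed.

Lemma weightA_ge0 n : 0 <= weightA A n.
Proof.
have [/weightA_gt0/ltW//|nA] := pselect (nlt n (lenA A)).
by rewrite /weightA zero_ext0.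
Qed.

Lemma weightA_nonincreasing n : weightA A n.+1 <= weightA A n.
Proof.
have [nA|nA] := pselect (nlt n.+1 (lenA A)); last first.
  by rewrite {1}/weightA zero_ext0// weightA_ge0.
have nA' : nlt n (lenA A) by move: nA; case: (lenA A) => //= k /ltnW.
by rewrite /weightA !zero_extE//; case: iA => _ /(_ n nA).
Qed.

Lemma norm1E : exists s : R, [/\ norm1 A = s%:E, sums_to Inf (weightA A) s & s <= 1].
Proof.
have [_ _] := iA; have w0 := weightA_ge0; move: w0; rewrite /norm1 /weightA.
case: (lenA A) => [k|] w0 n1.
  exists (\sum_(i < k) valA A i); split=> //; exact: (iffLR (sums_to_zero_ext (Fin k) _ _)).
set y := ereal_sup _ in n1 *; set v := valA A in y n1 *.
have wE : zero_ext Inf (valA A) = v by apply/funext => i; rewrite zero_extE.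
rewrite wE in w0 *.
have ub k : ((\sum_(i < k) v i)%:E <= y)%E by apply: ereal_sup_ubound; exists k.
have [r yE] : exists r, y = r%:E.
  case E : y => [r| |]; first by exists r.
    by move: n1; rewrite E.
  by have := ub 0%N; rewrite E leeNy_eq.
rewrite yE in ub n1 *; exists r; split=> //.
have {}ub k : \sum_(i < k) v i <= r by rewrite -lee_fin.
have [s hs] := sums_to_exists w0 ub.
suff -> : r = s by [].
apply/eqP; rewrite eq_le; apply/andP; split.
  rewrite -lee_fin -yE; apply: ge_ereal_sup => _ [k _ <-].
  by rewrite lee_fin; exact: sums_to_le.
rewrite -(cvg_lim _ hs)//; apply: limr_le; first by apply/cvg_ex; exists s.
exact: nearW.
Qed.

(** When the norm is zero all weights vanish and zero measures suffice. When it is below [1], index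
    [0] is the full pyramid and is removed by [decomposed_tail]. *)
Lemma mixsum_decomposed P X : (forall n, nlt n (lenA A) -> is_pyramid (P n)) ->
  mixsum A P X -> decomposed (weightA A) P X.
Proof.
move=> Ppyr; have [s [nE sA s1]] := norm1E; rewrite /mixsum nE.
have down n : nlt n (lenA A) -> forall X Y, P n X -> dominated Y X -> P n Y.
  by move=> /Ppyr[].
have val0 n : nlt n (lenA A) -> 0 <= valA A n.
  by move=> nA; have := weightA_ge0 n; rewrite /weightA zero_extE.
rewrite eqe lte_fin; case: eqP => [s0 _|_].
  have wz n : weightA A n = 0.
    apply/eqP; rewrite eq_le weightA_ge0 andbT -s0.
    apply: le_trans (sums_to_le weightA_ge0 sA n.+1).
    by rewrite big_ord_recr /= lerDr sumr_ge0// => i _; exact: weightA_ge0.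
  exists X; first exact: box_xx.
  exists (fun _ _ => 0); split=> [m|B bB K]; first by rewrite wz ltxx.
  rewrite big1 => [|i _]; last by rewrite mulr0.
  exact: (meas_ge0 (prob_meas (mm_prob X)) bB).
case: ltP => [slt|_]; last exact: dsum_decomposed.
set K := (X in dsum X); set w := (X in dsum _ X); set P' := (X in dsum _ _ X) => dX.
have KE n : nlt n.+1 K <-> nlt n (lenA A) by rewrite /K; case: (lenA A).
have wge i : nlt i K -> 0 <= w i.
  by case: i => [_|n /KE/val0//]; rewrite /w /= subr_ge0.
have wE : (fun i => zero_ext K w i.+1) = weightA A.
  apply/funext => n; rewrite /weightA /zero_ext.
  by rewrite (_ : `[< nlt n.+1 K >] = `[< nlt n (lenA A) >])//; exact: asbool_equiv_eq.
rewrite -wE; apply: (@decomposed_tail _ P').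
  move=> i; rewrite /zero_ext; case: asboolP => // /wge //.
by apply: dsum_decomposed => // -[//|n] /KE; exact: down.
Qed.

Lemma sums_to_unshift u (s : R) (J : nat) : sums_to Inf u s ->
  sums_to Inf (fun n => u (J + n)%N) (s - \sum_(i < J) u i).
Proof.
move=> us; have us' : (fun n => \sum_(i < n + J) u i) @ \oo --> s.
  by rewrite (cvg_shiftn J (fun n => \sum_(i < n) u i)).
have cJ : (fun _ : nat => \sum_(i < J) u i) @ \oo --> \sum_(i < J) u i by exact: cvg_cst.
rewrite /sums_to (_ : (fun n => _) =
  (fun n => \sum_(i < n + J) u i) - (fun _ : nat => \sum_(i < J) u i)).
  exact: cvgB us' cJ.
apply/funext => n; rewrite fctE addnC big_split_ord /=.
by rewrite addrAC subrr add0r.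
Qed.

(** For [0 < s < 1] the [J] light components together form one space [Z0], used for the summand of
    the full pyramid; the other components are included one by one. *)
Lemma test_chain_mixsum P (X : nat -> mmSpace R) s (s1 : s <= 1)
    (a0 : forall n, 0 <= weightA A n) (as_ : sums_to Inf (weightA A) s)
    (J : nat) (J0 : (0 < J)%N) (L : R) (L0 : 0 < L) :
  (forall n, nlt n (lenA A) -> P n (X n)) ->
  mixsum A P (chain_space (fun i => X (i - J)%N) L0
    (@test_weight_ge0 R J s (weightA A) s1 a0) (@test_weight_sum R J s (weightA A) J0 as_)).
Proof.
move=> PX; have [s' [nE sA _]] := norm1E.
rewrite /mixsum nE (sums_to_unique sA as_) => {s' nE sA}.
rewrite eqe lte_fin; case: eqP => // _.
set C := fun i => X (i - J)%N; set Z := chain_space _ _ _ _.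
have PC n : nlt n (lenA A) -> P n (C (J + n)%N) by rewrite /C addKn; exact: PX.
have tailw n : test_weight J s (weightA A) (J + n)%N = weightA A n.
  by rewrite /test_weight ltnNge leq_addr addKn.
have mZ B : borel (@mm_dist R Z) B -> sums_to Inf
    (fun i => test_weight J s (weightA A) i * mm_meas (@chain_incl R C i @^-1` B))
    (mm_meas B).
  exact: (chain_meas_sums_to (@test_weight_ge0 R J s _ s1 a0) (@test_weight_sum R J s _ J0 as_)).
have lincl i : lip1 (@chain_incl R C i : C i -> Z).
  by move=> x x'; rewrite [leLHS]chain_dist_incl.
case: ltP => [slt|sge].
- have z0 (n : nat) : 0 <= (0 : R) by [].
  have sz : sums_to Inf (fun _ : nat => 0 : R) 0.
    by have := @sums_to_finite R (fun _ => 0) 0; rewrite big_ord0; apply.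
  (* The same metric space as [Z], with mass [1 / J] on each of the first [J] components and none
     elsewhere; its map to [Z] is the identity. *)
  pose Z0 := chain_space C L0 (@test_weight_ge0 R J 0 (fun _ => 0) ler01 z0)
    (@test_weight_sum R J 0 (fun _ => 0) J0 sz).
  pose Xs i : mmSpace R := if i is n.+1 then C (J + n)%N else Z0.
  pose fs i : Xs i -> Z := match i return Xs i -> Z with
    | 0%N => fun z => z | n.+1 => @chain_incl R C (J + n)%N end.
  apply: (@dsum_intro _ _ _ _ Xs fs).
  + by case=> [//|n] nK; apply: PC; move: nK; case: (lenA A).
  + by case=> [_ z z'|n nK]; [exact: lexx|exact: (lincl (J + n)%N)].
  + move=> B bB; set K := (X in zero_ext X); set w := (X in zero_ext _ X).
    have w0 : zero_ext K w 0 = 1 - s by rewrite zero_extE// /K; case: (lenA A).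
    have wS n : zero_ext K w n.+1 = weightA A n.
      rewrite /weightA /zero_ext (_ : `[< nlt n.+1 K >] = `[< nlt n (lenA A) >])//.
      by apply: asbool_equiv_eq; rewrite /K; case: (lenA A).
    pose v i := test_weight J s (weightA A) i * mm_meas (@chain_incl R C i @^-1` B).
    have tl := sums_to_unshift (u := v) (J := J) (mZ B bB).
    have Z0B : @mm_meas R Z0 B = \sum_(i < J) J%:R^-1 * mm_meas (@chain_incl R C i @^-1` B).
      have := chain_meas_sums_to (@test_weight_ge0 R J 0 (fun _ => 0) ler01 z0)
        (@test_weight_sum R J 0 (fun _ => 0) J0 sz) bB.
      move/sums_to_unique; apply.
      have -> : \sum_(i < J) J%:R^-1 * mm_meas (@chain_incl R C i @^-1` B) =
          \sum_(i < J) test_weight J 0 (fun _ => 0) i * mm_meas (@chain_incl R C i @^-1` B).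
        by apply: eq_bigr => i _; rewrite /test_weight ltn_ord subr0 mul1r.
      apply: (@sums_to_finite R (fun i => test_weight J 0 (fun _ => 0) i *
        mm_meas (@chain_incl R C i @^-1` B))) => n Jn.
      by rewrite /test_weight ltnNge Jn mul0r.
    have vJ : \sum_(i < J) v i = (1 - s) * @mm_meas R Z0 B.
      rewrite Z0B big_distrr /=; apply: eq_bigr => i _.
      by rewrite /v /test_weight ltn_ord mulrA.
    have -> : mm_meas B = \sum_(i < 1) zero_ext K w i * mm_meas (fs i @^-1` B) +
        (mm_meas B - \sum_(i < J) v i).
      by rewrite big_ord1 w0 vJ addrC subrK.
    apply: sums_to_shift; have := tl; congr sums_to; apply/funext => n.
    by rewrite /v tailw wS.
- apply: (@dsum_intro _ _ _ Z (fun n => C (J + n)%N) (fun n => @chain_incl R C (J + n)%N)) => //.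
  move=> B bB; have tl := sums_to_unshift (J := J) (mZ B bB).
  (* In this case [s = 1], so the light components have weight zero. *)
  rewrite big1 ?subr0 in tl; last first.
    move=> i _; rewrite /test_weight ltn_ord (_ : s = 1) ?subrr ?mul0r//.
    by apply/eqP; rewrite eq_le s1.
  by have := tl; congr sums_to; apply/funext => n; rewrite tailw.
Qed.

End WeightA.
End DirectSums.

(** * Recovering weights and summands from the direct sum *)

Section Recovery.
Context {R : realType}.

Definition good_summand (A : @seqA R) (P : nat -> @mmpred R) :=
  forall n, nlt n (lenA A) -> is_pyramid (P n) /\ finite_obsdiam (P n).

(** The test chains built from [X] lie in the first sum, hence in the second, where they decompose;
    [exact_packing] then applies. *)
Lemma mixsum_packing (A B : @seqA R) (P Q : nat -> @mmpred R) (X : nat -> mmSpace R) :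
  inA A -> inA B -> good_summand B Q ->
  (forall X, mixsum A P X -> mixsum B Q X) ->
  (forall n, 0 < weightA A n -> P n (X n)) -> forall (K : nat) (eta : R), 0 < eta ->
  exists phi, packs (weightA B) (weightA A) K phi /\
    forall m, (m < K)%N -> 0 < weightA B m -> weightA A (phi m) = weightA B m ->
      close_in X (Q m) (phi m) eta.
Proof.
move=> iA iB gQ AB PX K eta eta0.
have [s [_ sA s1]] := norm1E iA; have [t [_ sB t1]] := norm1E iB.
apply: (exact_packing (weightA_ge0 iA) sA s1 (weightA_ge0 iB)) => //.
- by move=> n; apply: le_trans (sums_to_le (weightA_ge0 iB) sB n) t1.
- by move=> m /(weightA_gt0 iB)/gQ[].
- move=> s' s1' a0 as_ J J0 L L0; apply: mixsum_decomposed => //.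
    by move=> n /gQ[].
  apply: AB; apply: test_chain_mixsum => // n nA.
  by apply: PX; apply/(weightA_gt0 iA).
Qed.

Lemma mixsum_packs (A B : @seqA R) (P Q : nat -> @mmpred R) (X0 : mmSpace R) :
  inA A -> inA B -> good_summand A P -> good_summand B Q ->
  (forall X, mixsum A P X -> mixsum B Q X) ->
  forall K, exists phi, packs (weightA B) (weightA A) K phi.
Proof.
move=> iA iB gP gQ AB K.
have /choice[X PX] : forall n, exists X, 0 < weightA A n -> P n X.
  move=> n; have [/(weightA_gt0 iA)/gP[[[X PX]]]|h] := pselect (0 < weightA A n).
    by exists X.
  by exists X0.
by have [phi [? _]] := mixsum_packing iA iB gQ AB PX K ltr01; exists phi.
Qed.

Lemma mixsum_weights (A B : @seqA R) (P Q : nat -> @mmpred R) :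
  inA A -> inA B -> good_summand A P -> good_summand B Q ->
  (forall X, mixsum A P X <-> mixsum B Q X) -> weightA A =1 weightA B.
Proof.
move=> iA iB gP gQ AB.
(* [X0] is the default at indices of weight zero. If there were no mm-space there would be no
   pyramid, so both weight sequences would vanish. *)
have [[X0]|no] := pselect (inhabited (mmSpace R)); last first.
  have z (D : @seqA R) (S : nat -> @mmpred R) : inA D -> good_summand D S ->
      forall n, weightA D n = 0.
    move=> iD gS n; have [nD|nD] := pselect (nlt n (lenA D)).
      by have [[[X _]]] := gS n nD; case: no.
    by rewrite /weightA zero_ext0.
  by move=> n; rewrite (z A P) ?(z B Q).
apply: packs_antisym.
- exact: weightA_nonincreasing.
- exact: weightA_nonincreasing.
- exact: weightA_ge0.
- exact: weightA_ge0.
- by apply: (mixsum_packs X0 iA iB gP gQ) => X /AB.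
- by apply: (mixsum_packs X0 iB iA gQ gP) => X /AB.
Qed.

(** Each direction of the equality of sums gives a family of inclusions on the initial segment
    before a strict drop; [matching_block] combines the two. *)
Lemma mixsum_block (A B : @seqA R) (P Q : nat -> @mmpred R) (k : nat) :
  inA A -> inA B -> good_summand A P -> good_summand B Q ->
  (forall X, mixsum A P X <-> mixsum B Q X) ->
  (forall j, (j < k)%N -> weightA A k < weightA A j) ->
  exists tau : {ffun 'I_k -> 'I_k}, [/\ injective tau,
    forall m, weightA A (tau m) = weightA A m &
    forall (m : 'I_k) X, P m X <-> Q (tau m) X].
Proof.
move=> iA iB gP gQ AB drop.
have ab := funext (mixsum_weights iA iB gP gQ AB).
have nia := weightA_nonincreasing iA; have a0 := weightA_ge0 iA.
have Ppyr n : 0 < weightA A n -> is_pyramid (P n) by move=> /(weightA_gt0 iA)/gP[].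
have Qpyr n : 0 < weightA A n -> is_pyramid (Q n).
  by rewrite ab => /(weightA_gt0 iB)/gQ[].
have [|sigma [[si sa] PQ]] := @matching_inclusion R (weightA A) P Q k nia a0 drop Ppyr Qpyr.
- move=> X PX eta eta0.
  have [phi h] := mixsum_packing iA iB gQ (fun Y => iffLR (AB Y)) PX k eta0.
  by exists phi; move: h; rewrite -ab.
have [|tau [[ti ta] QP]] := @matching_inclusion R (weightA A) Q P k nia a0 drop Qpyr Ppyr.
- move=> X QX eta eta0.
  have QX' n : 0 < weightA B n -> Q n (X n) by rewrite -ab; exact: QX.
  have [phi h] := mixsum_packing iB iA gP (fun Y => iffRL (AB Y)) QX' k eta0.
  by exists phi; move: h; rewrite -ab.
by exists tau; split=> //; exact: matching_block si ti PQ QP.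
Qed.

(** The weights tend to zero, so there is a first index [k] of weight below [v]; all earlier weights
    are at least [v]. *)
Lemma weightA_drop (A : @seqA R) (v : R) : inA A -> 0 < v ->
  exists k : nat, (forall j, (j < k)%N -> weightA A k < weightA A j) /\
    forall n, weightA A n = v -> (n < k)%N.
Proof.
move=> iA v0; have nia := nonincreasing_leq (weightA_nonincreasing iA).
have ex : exists k, weightA A k < v.
  have [s [_ sA _]] := norm1E iA.
  have /cvgr_lt/(_ v v0)[k _ hk] : weightA A @ \oo --> (0 : R) by exact: sums_to_cvg0 sA.
  by exists k; exact: (hk k (leqnn k)).
case: (ex_minnP ex) => k kv kmin; exists k; split=> [j jk|n nv].
  apply: lt_le_trans kv _; rewrite leNgt; apply/negP => /kmin.
  by rewrite leqNgt jk.
by rewrite ltnNge; apply/negP => /nia; rewrite nv leNgt kv.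
Qed.

End Recovery.

Theorem theorem1p3 (R : realType) (A B : @seqA R)
  (P Q : nat -> @mmpred R) :
  inA A -> inA B ->
  (forall n, nlt n (lenA A) -> is_pyramid (P n) /\ finite_obsdiam (P n)) ->
  (forall n, nlt n (lenA B) -> is_pyramid (Q n) /\ finite_obsdiam (Q n)) ->
  (forall X, mixsum A P X <-> mixsum B Q X) ->
  lenA A = lenA B /\
  exists f : nat -> nat,
    [/\ forall n, nlt n (lenA A) -> nlt (f n) (lenA A),
        forall n m, nlt n (lenA A) -> nlt m (lenA A) -> f n = f m -> n = m,
        forall m, nlt m (lenA A) -> exists2 n, nlt n (lenA A) & f n = m &
        forall n, nlt n (lenA A) ->
          (forall X, P n X <-> Q (f n) X) /\ valA A n = valA B (f n)].
Proof.
move=> iA iB gP gQ AB.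
have ab := mixsum_weights iA iB gP gQ AB.
have nltE n : nlt n (lenA A) <-> 0 < weightA A n.
  by split=> [/(weightA_gt0 iA)|/(weightA_gt0 iA)].
have lenE : lenA A = lenA B.
  apply: natbar_ext => n; rewrite nltE ab.
  by split=> /(weightA_gt0 iB).
split=> //.
(* For each value [v], [F v] is an initial segment containing all indices of weight [v], with a
   weight-preserving permutation of it. Their restrictions to the sets of equal weight are glued
   into [f], also when there are infinitely many summands. *)
have /choice[F hF] : forall v : R, exists F : nat * (nat -> nat), 0 < v ->
    [/\ forall n, weightA A n = v -> (n < F.1)%N,
        forall n m, (n < F.1)%N -> (m < F.1)%N -> F.2 n = F.2 m -> n = m,
        forall m, (m < F.1)%N -> exists2 n, (n < F.1)%N & F.2 n = m &
        forall n, (n < F.1)%N -> weightA A (F.2 n) = weightA A n /\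
          forall X, P n X <-> Q (F.2 n) X].
  move=> v; have [v0|] := ltP 0 v; last by exists (0%N, id).
  have [k [drop kv]] := weightA_drop iA v0.
  have [tau [ti ta tPQ]] := mixsum_block iA iB gP gQ AB drop.
  pose g n := if insub n is Some i then nat_of_ord (tau i) else n.
  have gE (i : 'I_k) : g i = tau i by rewrite /g valK.
  exists (k, g) => _; split=> //=.
  - move=> n m nk mk; rewrite (gE (Ordinal nk)) (gE (Ordinal mk)).
    by move=> /val_inj/ti[].
  - move=> m mk; have [h hK tK] := injF_bij ti.
    by exists (h (Ordinal mk)) => //; rewrite gE tK.
  - by move=> n nk; rewrite (gE (Ordinal nk)); split; [exact: (ta (Ordinal nk))|exact: (tPQ (Ordinal nk))].
pose f n := (F (weightA A n)).2 n.
have fP n : nlt n (lenA A) -> weightA A (f n) = weightA A n /\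
    forall X, P n X <-> Q (f n) X.
  by move=> /nltE an; have [h1 _ _ h2] := hF _ an; apply: h2; exact: h1.
exists f; split.
- by move=> n nA; apply/nltE; rewrite (proj1 (fP n nA)); apply/nltE.
- move=> n m nA mA fnm; have [en _] := fP n nA; have [em _] := fP m mA.
  (* Equal images have equal weights, so both values of [f] come from the same injective
     permutation. *)
  have e : weightA A n = weightA A m by rewrite -en fnm em.
  have [h1 h2 _ _] := hF _ (iffLR (nltE n) nA).
  apply: h2; [exact: h1|exact: h1|]; rewrite -/(f n) fnm /f -e//.
- move=> m /nltE am; have [h1 _ h3 h4] := hF _ am.
  have [n nk nm] := h3 m (h1 m erefl); have [en _] := h4 n nk.
  have e : weightA A n = weightA A m by rewrite -en nm.
  by exists n; [apply/nltE; rewrite e|rewrite /f e].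
- move=> n nA; have [en PQ] := fP n nA; split=> //.
  have fA : nlt (f n) (lenA B) by rewrite -lenE; apply/nltE; rewrite en; apply/nltE.
  by rewrite -(zero_extE (valA A) nA) -(zero_extE (valA B) fA) -/(weightA A n)
    -/(weightA B (f n)) -en ab.
Qed.
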